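(* Let $\varepsilon>0$ and let $k,\ell$ be fixed integers with $1\le \ell\le k$. There exists $C=C(\ell,k,\varepsilon)>0$ such that the following holds. Let $\mathcal{H}$ be a $k$-uniform hypergraph on $n$ vertices with $k\mid n$ and $\delta_\ell(\mathcal{H})\ge(\delta_{\ell,k}^{+}+\varepsilon)\binom{n}{k-\ell}$. Then the random hypergraph $\mathcal{H}(C\log n/n^{k-1})$ contains a perfect matching with high probability.
   Context: For a $k$-uniform hypergraph $H$ and $S\subseteq V(H)$, $\deg_H(S)$ is the number of hyperedges containing $S$. For $1\le\ell\le k$, $\delta_\ell(H)$ is the minimum of $\deg_H(S)$ over all $S\subseteq V(H)$ with $|S|=\ell$. For $n\in k\mathbb{N}$ let $t(n,k,\ell)$ be the smallest $d$ such that every $n$-vertex $k$-uniform hypergraph $H$ with $\delta_\ell(H)\ge d$ contains a perfect matching (a set of pairwise disjoint hyperedges covering all vertices). The $\ell$-degree Dirac threshold is $\delta_{\ell,k}^{+}=\lim_{n\to\infty,\ k\mid n} t(n,k,\ell)/\binom{n}{k-\ell}$; this limit is known to exist. For $p\in[0,1]$, $\mathcal{H}(p)$ is the random hypergraph on the vertex set of $\mathcal{H}$ in which each hyperedge of $\mathcal{H}$ is retained with probability $p$, independently (a value $p>1$ is read as $1$). ''With high probability'' means with probability tending to $1$ as $n\to\infty$ (along multiples of $k$), for any choice of hypergraphs $\mathcal{H}$ satisfying the hypotheses. *)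

(* Defs.v *)
From HB Require Import structures.
From mathcomp Require Import all_boot all_order all_algebra.
From mathcomp Require Import all_classical all_reals all_analysis.

Set Implicit Arguments.
Unset Strict Implicit.
Unset Printing Implicit Defensive.

Import Order.TTheory GRing.Theory Num.Theory.
Import numFieldNormedType.Exports.

Local Open Scope ring_scope.

Definition uniform (V : finType) (k : nat) (H : {set {set V}}) : bool :=
  [forall e in H, #|e| == k].

Definition degree (V : finType) (H : {set {set V}}) (S : {set V}) : nat :=
  #|[set e in H | S \subset e]|.

(* No degree exceeds #|H|, so the initial value #|H| is harmless as soon as   *)
(* #|V| >= l; it is the value taken when V has no l-subset.                   *)
Definition min_degree (V : finType) (l : nat) (H : {set {set V}}) : nat :=
  \big[minn/#|H|]_(S : {set V} | #|S| == l) degree H S.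

Definition perfect_matching (V : finType) (H M : {set {set V}}) : bool :=
  [&& M \subset H, finset.trivIset M & finset.cover M == [set: V]].

Definition has_perfect_matching (V : finType) (H : {set {set V}}) : bool :=
  [exists M : {set {set V}}, perfect_matching H M].

Definition degree_forces_pm (n k l d : nat) : bool :=
  [forall H : {set {set 'I_n}},
     uniform k H && (d <= min_degree l H)%N ==> has_perfect_matching H].

Lemma min_degree_le_card (V : finType) (l : nat) (H : {set {set V}}) :
  (min_degree l H <= #|H|)%N.
Proof.
rewrite /min_degree; elim/big_rec: _ => // S d _ le_dH.
exact: leq_trans (geq_minr _ _) le_dH.
Qed.

Lemma leq_min_degreeP (V : finType) (l d : nat) (H : {set {set V}}) :
  (l <= #|V|)%N ->
  reflect (forall S : {set V}, #|S| = l -> (d <= degree H S)%N)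
          (d <= min_degree l H)%N.
Proof.
move=> le_lV; apply: (iffP idP) => [+ S /eqP cS|d_le].
  rewrite /min_degree; move: (mem_index_enum S).
  elim: (index_enum _) => //= T r IHr; rewrite inE big_cons.
  case/orP=> [/eqP <-|/IHr {}IHr]; first by rewrite cS leq_min => /andP[].
  by case: ifP => // _; rewrite leq_min => /andP[_].
rewrite /min_degree; elim/big_rec: _ => [|S m /eqP /d_le dS dm]; last first.
  by rewrite leq_min dS.
have : (0 < #|[set A : {set V} | A \subset [set: V] & #|A| == l]|)%N.
  by rewrite cards_draws bin_gt0 cardsT.
case/card_gt0P=> S; rewrite inE => /andP[_ /eqP /d_le dS].
apply: leq_trans dS (subset_leq_card _).
by apply/fintype.subsetP => e; rewrite inE => /andP[].
Qed.

Lemma degree_forces_pm_ex (n k l : nat) : exists d, degree_forces_pm n k l d.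
Proof.
exists #|{set 'I_n}|.+1; apply/forallP => H; apply/implyP => /andP[_ ltH].
by have := leq_trans ltH (leq_trans (min_degree_le_card l H) (max_card _));
  rewrite ltnn.
Qed.

Definition pm_degree (n k l : nat) : nat := ex_minn (degree_forces_pm_ex n k l).

Definition dirac_threshold (R : realType) (l k : nat) : R :=
  limn (fun m : nat =>
    (pm_degree (m * k) k l)%:R / 'C(m * k, k - l)%:R : R).

(* Law of the random subhypergraph H(p): the outcomes are the G \subset H,    *)
(* weighted by the product of the Bernoulli(p) laws of the hyperedges of H.   *)
Definition random_sub_weight (R : realType) (V : finType) (p : R)
    (H G : {set {set V}}) : R :=
  \prod_(e in H) (if e \in G then p else 1 - p).

Definition random_sub_prob (R : realType) (V : finType) (p : R)
    (H : {set {set V}}) (A : pred {set {set V}}) : R :=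
  \sum_(G : {set {set V}} | (G \subset H) && A G) random_sub_weight p H G.

Lemma random_sub_prob_total (R : realType) (V : finType) (p : R)
    (H : {set {set V}}) : random_sub_prob p H predT = 1.
Proof.
pose F e b : R := if e \in H then (if b then p else 1 - p) else (~~ b)%:R.
have E1 : \prod_(e : {set V}) \sum_(b : bool) F e b = 1.
  apply: big1 => e _; rewrite big_bool /F; case: ifP => _ /=.
    by rewrite addrC subrK.
  by rewrite add0r.
rewrite -E1 bigA_distr_bigA /=.
rewrite [RHS](reindex (fun G : {set {set V}} => [ffun e => e \in G])) /=;
  last first.
  exists (fun f : {ffun {set V} -> bool} => finset f) => [G _|f _].
    by apply/setP => e; rewrite inE ffunE.
  by apply/ffunP => e; rewrite ffunE inE.
rewrite [RHS](bigID (fun G : {set {set V}} => G \subset H)) /=.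
rewrite [X in _ = _ + X]big1 ?addr0.
  apply: eq_big => [G|G]; first by rewrite andbT.
  move=> /andP[/fintype.subsetP GH _]; rewrite /random_sub_weight big_mkcond /=.
  apply: eq_bigr => e _; rewrite ffunE /F; case: ifP => // /negbT eH.
  by rewrite (contra (GH e) eH).
move=> G /fintype.subsetPn[e eG eH]; rewrite (bigD1 e) //= ffunE /F (negPf eH) eG.
by rewrite mul0r.
Qed.

(* Main.v *)
(* The perfect matchings of H carry a probability measure which is spread: a  *)
(* set T of hyperedges is contained in the random matching with probability   *)
(* at most (C / n^(k-1))^|T|.                                                 *)
(*                                                                            *)
(* To construct it, fix a large m.  By concentration, all but a tiny          *)
(* proportion of the m-sets through any given vertex inherit the minimum      *)
(* degree condition, hence span a perfect matching by definition of the       *)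
(* threshold; call them good.  Take a uniformly random partition into good    *)
(* m-sets (after removing boundedly many random hyperedges, so that m divides *)
(* n).  Replacing a block and m partner blocks by m + 1 transversal blocks    *)
(* yields good blocks for most choices of the partners.  Double counting such *)
(* switches shows both that prescribing the positions of a few vertices costs *)
(* a factor C / n per vertex, and that a proportion at least c^n of all       *)
(* partitions is good, which handles the case of many vertices.  The same     *)
(* argument compares the thresholds for n and m vertices, whence the limit    *)
(* defining dirac_threshold exists.                                           *)
(*                                                                            *)
(* A spread measure yields the random statement by the minimal fragment       *)
(* argument (Alweiss-Lovasz-Wu-Zhang, Frankston-Kahn-Narayanan-Park): after   *)
(* exposing a random set W of density 8q, for almost all pairs (W, S) some    *)
(* member of the support inside W :|: S has at most half of S left outside W. *)
(* About log n rounds leave fragments of bounded size, and one round of       *)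
(* density q log n covers those.                                              *)
Require Import Defs.
From HB Require Import structures.
From mathcomp Require Import all_boot all_order all_algebra.
From mathcomp Require Import all_classical all_reals all_analysis.
From mathcomp Require Import ring lra zify.
Set Implicit Arguments.
Unset Strict Implicit.
Unset Printing Implicit Defensive.

Import Order.TTheory GRing.Theory Num.Theory.
Import numFieldNormedType.Exports.
Local Open Scope ring_scope.

(** * Random subsets *)

(** It suffices to find on the perfect matchings of [H] a probability measure of spread q = C /
    n^(k-1). [dirac_spread] constructs it from the degree condition, and [spread_matchings_prob]
    turns it into the random statement.

    Spread to random: after a random W is exposed, each matching S is replaced by the smallest
    remainder outside W of a matching inside the union of W and S. By [large_fragments] the
    remainders of more than half the size carry little mass on average, and the others form a weight
    with the same spread q. A round costs density 8q and halves the size, so the O(log n) rounds of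
    [fail_rounds], with a last round of density q ln n, give the density 25 q ln n.

    Degree to spread: a set of m vertices that spans no perfect matching contains an l-set of too
    small degree inside it. For each l-set this has probability exponentially small in m, which
    beats the number of l-sets ([card_bad_rows], [few_bad_rows]). So almost all m-sets are
    matchable, and A is cut into N matchable blocks. In a random such partition, prescribing the
    positions of x vertices has probability at most (c / N)^x: switchings give this for few vertices
    ([arrangements_step]), and for many vertices a crude count is enough because a proportion c^N of
    all placements is good ([repair]); [arrangements_spread] joins the two. An edge has N possible
    blocks and k vertices to place, hence probability of order N * N^(-k), which is the exponent k -
    1 ([card_block_matching_sup]). *)

Section RandomSubsets.
Variables (R : realType) (V : finType).
Implicit Types (p q : R) (D W : {set {set V}}) (A : pred {set {set V}}).

Local Notation w := (@random_sub_weight R V).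

Lemma random_sub_weightE p D W : W \subset D ->
  w p D W = p ^+ #|W| * (1 - p) ^+ (#|D| - #|W|).
Proof.
move=> WD; rewrite /random_sub_weight (bigID (mem W)) /=.
rewrite (eq_bigr (fun=> p)) => [|e /andP[_ ->]//].
rewrite [X in _ * X](eq_bigr (fun=> 1 - p)) => [|e /andP[_ /negPf ->]//].
rewrite !prodr_const -cardsDS //; congr (_ ^+ _ * _ ^+ _); apply: eq_card => e.
  rewrite unfold_in; apply/andP/idP => [[]//|eW]; split=> //.
  exact: (fintype.subsetP WD).
by rewrite !inE andbC.
Qed.

Lemma random_sub_weight_ge0 p D W : 0 <= p <= 1 -> 0 <= w p D W.
Proof.
move=> /andP[p0 p1]; apply: prodr_ge0 => e _; case: ifP => // _.
by rewrite subr_ge0.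
Qed.

Lemma sum_random_sub_weight p D : \sum_(W : {set {set V}} | W \subset D)
  w p D W = 1.
Proof.
by rewrite -(random_sub_prob_total p D); apply: eq_bigl => G; rewrite andbT.
Qed.

Lemma random_sub_prob_le1 p D A : 0 <= p <= 1 -> random_sub_prob p D A <= 1.
Proof.
move=> hp; rewrite -(random_sub_prob_total p D) /random_sub_prob.
rewrite [leRHS](bigID A) /=.
have -> : \sum_(G : {set {set V}} | (G \subset D) && predT G && A G) w p D G =
  \sum_(G : {set {set V}} | (G \subset D) && A G) w p D G.
  by apply: eq_bigl => G; rewrite andbT.
by rewrite lerDl; apply: sumr_ge0 => G _; exact: random_sub_weight_ge0.
Qed.

Lemma random_sub_probC p D A :
  random_sub_prob p D A = 1 - random_sub_prob p D (predC A).
Proof.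
apply/eqP; rewrite eq_sym subr_eq -(random_sub_prob_total p D); apply/eqP.
rewrite /random_sub_prob [LHS](bigID A) /=; congr (_ + _); apply: eq_bigl => G;
  by rewrite andbT.
Qed.

(** Edge by edge, both independent sets miss an edge with probability (1 - p)(1 - p'). The product
    over edges of sums over pairs of bits is expanded, and families of pairs of bits are pairs of
    sets. This permits exposure in rounds. *)
Lemma random_sub_union p p' D (f : {set {set V}} -> R) :
  \sum_(W : {set {set V}} | W \subset D)
    \sum_(W' : {set {set V}} | W' \subset D)
     w p D W * w p' D W' * f (W :|: W') =
  \sum_(W : {set {set V}} | W \subset D) w (1 - (1 - p) * (1 - p')) D W * f W.
Proof.
pose g (b : bool * bool) : R :=
  (if b.1 then p else 1 - p) * (if b.2 then p' else 1 - p').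
(* Outside [D] the factor forces both bits to be false, so only pairs of subsets of [D] survive in
   the expansion. *)
pose F (Z : {set {set V}}) e b : R :=
  if e \in D then ((b.1 || b.2) == (e \in Z))%:R * g b
                    else (~~ (b.1 || b.2))%:R.
have E1 (Z : {set {set V}}) : Z \subset D ->
    w (1 - (1 - p) * (1 - p')) D Z = \prod_e \sum_b F Z e b.
  move=> ZD; rewrite /random_sub_weight [LHS]big_mkcond /=; apply: eq_bigr =>
    e _.
  rewrite -(pair_bigA _ (fun b1 b2 => F Z e (b1, b2))) /= !big_bool /= /F /g /=.
  by case: (e \in D) => /=; case: (e \in Z) => /=; ring.
pose h (f0 : {ffun {set V} -> bool * bool}) : {set {set V}} * {set {set V}} :=
  ([set e | (f0 e).1], [set e | (f0 e).2]).
pose h' (X : {set {set V}} * {set {set V}}) : {ffun {set V} -> bool * bool} :=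
  [ffun e => (e \in X.1, e \in X.2)].
have hK : cancel h h'.
  by move=> f0; apply/ffunP => e; rewrite ffunE !inE; case: (f0 e).
have h'K : cancel h' h.
  by move=> [X Y]; congr (_, _); apply/setP => e; rewrite inE ffunE.
have E2 (Z : {set {set V}}) : Z \subset D -> w (1 - (1 - p) * (1 - p')) D Z =
    \sum_(X : {set {set V}} * {set {set V}} |
          [&& X.1 \subset D, X.2 \subset D & X.1 :|: X.2 == Z])
       w p D X.1 * w p' D X.2.
  move=> ZD; rewrite E1 // bigA_distr_bigA /= (reindex h') /=; last first.
    by exists h => x _; [exact: h'K|exact: hK].
  rewrite (bigID (fun X : {set {set V}} * {set {set V}} =>
    [&& X.1 \subset D, X.2 \subset D & X.1 :|: X.2 == Z])) /=.
  rewrite [X in _ + X]big1 ?addr0.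
    apply: eq_bigr => [[X Y] /= /and3P[XD YD /eqP XYZ]].
    rewrite /random_sub_weight -big_split /= [RHS]big_mkcond /=.
    apply: eq_bigr => e _; rewrite ffunE /F /= -XYZ inE eqxx mul1r.
    case: ifP => // /negbT eD; rewrite (contraNF (fintype.subsetP XD e)) //.
    by rewrite (contraNF (fintype.subsetP YD e)).
  move=> [X Y] /= XYZ; apply/eqP/prodf_eq0.
  suff [e He] : exists e, ~~ (if e \in D then (e \in X) || (e \in Y)
    == (e \in Z)
                          else ~~ ((e \in X) || (e \in Y))).
    exists e => //; rewrite ffunE /F /=; move: He.
    by case: ifP => _ /negPf ->; rewrite ?mul0r.
  apply/existsP; rewrite -negb_forall; apply: contra XYZ => /forallP XYZ.
  have HX e : (e \in X) || (e \in Y) -> e \in D.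
    by move=> He; have := XYZ e; case: ifP => // _; rewrite He.
  apply/and3P; split.
  - by apply/fintype.subsetP => e eX; apply: HX; rewrite eX.
  - by apply/fintype.subsetP => e eX; apply: HX; rewrite eX orbT.
  apply/eqP/setP => e; rewrite inE; have := XYZ e.
  case: ifP => [_ /eqP //|/negbT eD /negPf ->].
  by rewrite (contraNF (fintype.subsetP ZD e)).
rewrite [RHS](eq_bigr _ (fun W WD => congr1 (fun x => x * f W) (E2 W WD))).
under [RHS]eq_bigr do rewrite mulr_suml.
rewrite pair_big_dep /= [RHS](exchange_big_dep
  (fun X : {set {set V}} * {set {set V}} => (X.1 \subset D) && (X.2 \subset D)))
  /=; last by move=> W0 X0 WD /and3P[-> -> _].
apply: eq_bigr => [[X Y]] /= /andP[XD YD].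
rewrite (big_pred1 (X :|: Y)) // => W; rewrite XD YD /= eq_sym.
by case: eqP => [->|]; rewrite ?andbF // andbT finset.subUset XD YD.
Qed.

End RandomSubsets.

(** * Spread weights and minimal fragments *)

(** Adding b elements to an a-subset of a c-set multiplies its Bernoulli weight by (p / (1 - p))^b,
    which is at least p^b. The form without division includes p = 1. *)
Lemma bernoulli_shift (R : realType) (p : R) (a b c : nat) :
  0 <= p <= 1 -> (a + b <= c)%N ->
  p ^+ a * (1 - p) ^+ (c - a) * p ^+ b <=
    p ^+ (a + b) * (1 - p) ^+ (c - (a + b)).
Proof.
move=> /andP[p0 p1] abc; have q0 : 0 <= 1 - p by rewrite subr_ge0.
have -> : (c - a = c - (a + b) + b)%N by rewrite subnDA subnK // leq_subRL //
  (leq_trans _ abc) // leq_addr.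
rewrite !exprD mulrAC mulrA ler_piMr ?exprn_ile1 ?gerBl //.
by rewrite !mulr_ge0 ?exprn_ge0.
Qed.


Section SpreadWeights.
Variables (R : realType) (V : finType).
Implicit Types (p q x : R) (D W S T Z : {set {set V}}).
Implicit Types (mu : {set {set V}} -> R) (s t : nat).

Local Notation w := (@random_sub_weight R V).

Definition spread q mu :=
  forall T, \sum_(S : {set {set V}} | T \subset S) mu S <= q ^+ #|T|.

Definition mass mu : R := \sum_S mu S.

(* The mass is not normalised, so that discarding outcomes preserves spread.   *)
Definition spread_weight q D s mu :=
  [/\ forall S, 0 <= mu S,
      forall S, mu S != 0 -> (S \subset D) && (#|S| <= s)%N
    & spread q mu].

Definition covers mu : pred {set {set V}} :=
  fun W => [exists S : {set {set V}}, (mu S != 0) && (S \subset W)].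

Definition fail p D mu : R := random_sub_prob p D (predC (covers mu)).

Lemma spread_weight_mass_le1 q D s mu : spread_weight q D s mu -> mass mu <= 1.
Proof.
case=> _ _ /(_ finset.set0); rewrite cards0 expr0.
by under eq_bigl => S do rewrite finset.sub0set.
Qed.

Definition fragment mu S W : {set {set V}} :=
  [arg min_(S' < S | (mu S' != 0) && (S' \subset W :|: S)) #|S' :\: W|] :\: W.

(** For the last clause: a member of the support inside [W :|: T] has its remainder outside [W]
    contained in [T], so by minimality the remainder is [T] itself. Hence any such member, chosen
    without knowledge of [W] and [S], contains the fragment. *)
Lemma fragmentP mu S W : mu S != 0 ->
  let T := fragment mu S W in
  [/\ T \subset S, [disjoint T & W],
      exists S', [/\ mu S' != 0, S' \subset W :|: T & T \subset S']
    & forall S', mu S' != 0 -> S' \subset W :|: T -> T \subset S'].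
Proof.
move=> muS /=; rewrite /fragment; case: arg_minnP => [|S0 /andP[mu0 S0S] min0].
  by rewrite muS finset.subsetUr.
have sTS : S0 :\: W \subset S by rewrite finset.subDset.
split=> //.
- by rewrite finset.disjoints_subset; apply/fintype.subsetP => e;
  rewrite !inE => /andP[].
- exists S0; split=> //; last exact: finset.subsetDl.
  by apply/fintype.subsetP => e eS; rewrite !inE eS; case: (e \in W).
move=> S' mu' S'sub.
have S'S : S' \subset W :|: S by apply: fintype.subset_trans S'sub (finset.setUS _ sTS).
have S'D : S' :\: W \subset S0 :\: W.
  rewrite finset.subDset; apply: fintype.subset_trans S'sub _.
  by apply/fintype.subsetP => e; rewrite !inE.
have /eqP <- : S' :\: W == S0 :\: W.
  by rewrite eqEcard S'D min0 // mu' S'S.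
exact: finset.subsetDl.
Qed.

Lemma sum_expr_subsets x (B : {set {set V}}) s t : 0 <= x <= 1 -> (#|B| <=
  s)%N ->
  \sum_(T : {set {set V}} | (T \subset B) && (t <= #|T|)%N) x ^+ #|T|
    <= 2 ^+ s * x ^+ t.
Proof.
move=> /andP[x0 x1] Bs.
apply: (@le_trans _ _ (\sum_(T : {set {set V}} | (T \subset B) && (t <=
  #|T|)%N) x ^+ t)).
  by apply: ler_sum => T /andP[_ tT]; apply: ler_wiXn2l.
rewrite sumr_const -[leLHS]mulr_natl ler_wpM2r ?exprn_ge0 //.
rewrite -natrX ler_nat (leq_trans _ (leq_pexp2l (ltn0Sn 1) Bs)) //.
rewrite -card_powerset subset_leq_card //.
by apply/fintype.subsetP => T; rewrite unfold_in powersetE => /andP[].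
Qed.

(* Encode the pair (W, S) by Z = W :|: T and T = fragment mu S W: T is then a *)
(* subset of a member of the support depending on Z only.                     *)
Lemma large_fragments p q D s t mu :
  0 < p -> p <= 1 -> 0 <= q -> q <= p -> spread_weight q D s mu ->
  \sum_(W : {set {set V}} | W \subset D)
    w p D W * \sum_(S : {set {set V}} | (t <= #|fragment mu S W|)%N) mu S
  <= 2 ^+ s * (q / p) ^+ t.
Proof.
move=> p0 p1 q0 qp [mu0 muD muspread].
have hp : 0 <= p <= 1 by rewrite (ltW p0).
have hx : 0 <= q / p <= 1.
  by rewrite divr_ge0 ?(ltW p0) //= ler_pdivrMr // mul1r.
pose Sel Z : {set {set V}} :=
  if [pick S : {set {set V}} | (mu S != 0) && (S \subset Z)] is Some S1 then S1
  else finset.set0.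
have SelP Z : (#|Sel Z| <= s)%N.
  rewrite /Sel; case: pickP => [S /andP[/muD/andP[]//]|_].
  by rewrite cards0.
pose ok W T := [&& [disjoint T & W], W :|: T \subset D, (t <= #|T|)%N
                 & T \subset Sel (W :|: T)].
(* Group the sets S by their fragment T. Since T lies in S, each group has mass at most q^|T| by
   spread. *)
have stepW W : W \subset D ->
    \sum_(S : {set {set V}} | (t <= #|fragment mu S W|)%N) mu S
      <= \sum_(T | ok W T) q ^+ #|T|.
  move=> WD; rewrite (bigID (fun S => mu S != 0)) /= [X in _ + X]big1 ?addr0;
    last by move=> S /andP[_ /negPn/eqP].
  rewrite (partition_big (fun S => fragment mu S W) (ok W)) /=.
    apply: ler_sum => T _; apply: le_trans (muspread T).
    rewrite big_mkcond [leRHS]big_mkcond; apply: ler_sum => S _ /=.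
    case: ifP => [/andP[/andP[_ muS] /eqP <-]|_]; last by case: ifP.
    by have [-> _ _ _] := fragmentP W muS.
  move=> S /andP[tS muS]; have [TS TW [S' [mu' S'sub TS']] Tmin] :=
    fragmentP W muS.
  apply/and4P; split=> //.
    rewrite finset.subUset WD (fintype.subset_trans TS) //.
    by case/andP: (muD _ muS).
  rewrite /Sel; case: pickP => [S0 /andP[m0 s0]|/(_ S')]; first exact: Tmin.
  by rewrite mu' S'sub.
(* Pass from the weight of W to that of [W :|: T], which costs p^-|T|. *)
apply: (@le_trans _ _ (\sum_(W : {set {set V}} | W \subset D) \sum_(T | ok W T)
    w p D (W :|: T) * (q / p) ^+ #|T|)).
  apply: ler_sum => W WD; apply: le_trans (ler_wpM2l _ (stepW W WD)) _.
    exact: random_sub_weight_ge0.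
  rewrite mulr_sumr; apply: ler_sum => T /and4P[TW WTD _ _].
  rewrite !random_sub_weightE // expr_div_n mulrA ler_pdivlMr ?exprn_gt0 //.
  rewrite mulrAC ler_wpM2r ?exprn_ge0 //.
  have cWT : #|W :|: T| = (#|W| + #|T|)%N.
    rewrite cardsU (_ : W :&: T = finset.set0) ?cards0 ?subn0 //.
    by apply/eqP; rewrite finset.setI_eq0 disjoint_sym.
  have cD : (#|W| + #|T| <= #|D|)%N by rewrite -cWT subset_leq_card.
  by rewrite cWT bernoulli_shift.
rewrite (exchange_big_dep predT) //=.
apply: (@le_trans _ _ (\sum_(T : {set {set V}}) \sum_(Z : {set {set V}} |
   [&& Z \subset D, (t <= #|T|)%N & T \subset Sel Z]) w p D Z * (q / p)
     ^+ #|T|)).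
  apply: ler_sum => T _.
  pose P := [set W : {set {set V}} | (W \subset D) && ok W T].
  have injP : {in P &, injective (fun W => W :|: T)}.
    have aux W : W \in P -> (W :|: T) :\: T = W.
      rewrite inE => /andP[_ /and4P[dTW _ _ _]]; apply/setP => e; rewrite !inE.
      case: (boolP (e \in T)) => eT /=; last by rewrite orbF.
      by rewrite (disjointFr dTW eT).
    by move=> W W' /aux E /aux E' h; rewrite -E h E'.
  rewrite (eq_bigl (mem P)); last by move=> W; rewrite /= inE.
  rewrite -(big_imset (fun Z => w p D Z * (q / p) ^+ #|T|) injP) /=.
  rewrite big_mkcond [leRHS]big_mkcond; apply: ler_sum => Z _.
  case: ifP => [/imsetP[W + ->]|_].
    by rewrite inE => /andP[_ /and4P[_ -> -> ->]].
  case: ifP => // /and3P[ZD _ _].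
  by rewrite mulr_ge0 ?random_sub_weight_ge0 // exprn_ge0 //; case/andP: hx.
rewrite (exchange_big_dep (fun Z : {set {set V}} => Z \subset D)) /=;
  last by move=> T Z _ /and3P[].
rewrite -[leRHS]mul1r -[X in _ <= X * _](sum_random_sub_weight p D) mulr_suml.
apply: ler_sum => Z ZD; rewrite -mulr_sumr ler_wpM2l ?random_sub_weight_ge0 //.
apply: le_trans (sum_expr_subsets t hx (SelP Z)).
by rewrite le_eqVlt; apply/orP; left; apply/eqP/eq_bigl => T;
  rewrite ZD /= andbC.
Qed.

(** The push-forward of [mu] under the fragment map, after discarding the fragments with more than
    [t] elements. *)
Definition fragment_weight mu t W : {set {set V}} -> R :=
  fun T => \sum_(S | (mu S != 0) && ((#|fragment mu S W| <= t)%N &&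
    (fragment mu S W == T))) mu S.

Lemma fragment_weight_spread q D s t mu W :
  spread_weight q D s mu -> spread_weight q D t (fragment_weight mu t W).
Proof.
move=> [mu0 muD muspread]; split=> [T|T|T].
- exact: sumr_ge0.
- move=> nz; have [S /and3P[muS tS /eqP <-]] :
      exists S, (mu S != 0) && ((#|fragment mu S W| <= t)%N &&
        (fragment mu S W == T)).
    apply/existsP; apply: contra_neqT nz; rewrite negb_exists => /forallP H.
    by apply: big1 => S; rewrite (negPf (H S)).
  rewrite tS andbT; have [TS _ _ _] := fragmentP W muS.
  by apply: fintype.subset_trans TS _; case/andP: (muD _ muS).
apply: le_trans (muspread T); rewrite /fragment_weight.
rewrite (exchange_big_dep (fun S => T \subset S)) /=; last first.
  move=> T' S TT' /and3P[muS _ /eqP E]; apply: fintype.subset_trans TT' _.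
  by rewrite -E; have [] := fragmentP W muS.
apply: ler_sum => S TS; rewrite sumr_const -[leRHS]mulr1n.
apply: ler_wpMn2l => //; rewrite -(card1 (fragment mu S W)) subset_leq_card //.
by apply/fintype.subsetP => T'; rewrite !unfold_in => /and4P[_ _ _ /eqP ->].
Qed.

Lemma fragment_weight_mass mu t W :
  mass mu - \sum_(S : {set {set V}} | (t < #|fragment mu S W|)%N) mu S
    = mass (fragment_weight mu t W).
Proof.
apply/eqP; rewrite subr_eq; apply/eqP.
rewrite /mass /fragment_weight (exchange_big_dep predT) //=.
rewrite [LHS](bigID (fun S => (#|fragment mu S W| <= t)%N)) /=; congr (_ + _).
  rewrite [RHS](eq_bigr (fun S => if (#|fragment mu S W| <=
    t)%N then mu S else 0)).
    by rewrite -big_mkcond.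
  move=> S _; case: (eqVneq (mu S) 0) => [->|muS] /=;
    first by rewrite big_pred0 // if_same.
  case: ifP => _ /=; last by rewrite big_pred0.
  by rewrite (big_pred1 (fragment mu S W)) // => T; rewrite /= eq_sym.
by apply: eq_bigl => S; rewrite ltnNge.
Qed.

Lemma covers_fragment mu t W W' :
  covers (fragment_weight mu t W) W' -> covers mu (W :|: W').
Proof.
move=> /existsP[T /andP[nz TW']]; have [S /and3P[muS _ /eqP E]] :
    exists S, (mu S != 0) && ((#|fragment mu S W| <= t)%N &&
      (fragment mu S W == T)).
  apply/existsP; apply: contra_neqT nz; rewrite negb_exists => /forallP H.
  by apply: big1 => S; rewrite (negPf (H S)).
have [_ _ [S' [mu' S'sub _]] _] := fragmentP W muS.
apply/existsP; exists S'; rewrite mu' (fintype.subset_trans S'sub) //.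
by rewrite E finset.setUS.
Qed.

(** One round. Condition on the first exposed set W: the second set only has to cover a fragment of
    size at most [t], whose weight is still q-spread. The mass lost to larger fragments averages to
    the term controlled by [large_fragments]. *)
Lemma fail_step p p' q D s t mu (b : R) :
  0 < p -> p <= 1 -> 0 <= p' <= 1 -> 0 <= q -> q <=
    p -> spread_weight q D s mu ->
  (forall nu, spread_weight q D t nu -> fail p' D nu <= 1 - mass nu + b) ->
  fail (1 - (1 - p) * (1 - p')) D mu
    <= 1 - mass mu + 2 ^+ s * (q / p) ^+ t.+1 + b.
Proof.
move=> p0 p1 hp' q0 qp hmu hnu.
have hp : 0 <= p <= 1 by rewrite (ltW p0).
rewrite /fail /random_sub_prob big_mkcondr /=.
rewrite (eq_bigr (fun W => w (1 - (1 - p) * (1 - p')) D W *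
   (~~ covers mu W)%:R)); last first.
  by move=> W _; case: ifP; rewrite ?mulr1 ?mulr0.
rewrite -random_sub_union.
apply: (@le_trans _ _ (\sum_(W : {set {set V}} | W \subset D)
   w p D W * (1 - mass mu + \sum_(S | (t < #|fragment mu S W|)%N) mu S + b))).
  apply: ler_sum => W WD.
  have := hnu _ (fragment_weight_spread t W hmu).
  rewrite -fragment_weight_mass opprB addrCA addrC => /le_trans hle.
  under eq_bigr do rewrite -mulrA.
  rewrite -mulr_sumr ler_wpM2l ?random_sub_weight_ge0 //.
  apply: (le_trans _ (hle _ _)); last by rewrite le_eqVlt; apply/orP; left;
    apply/eqP; ring.
  rewrite /fail /random_sub_prob big_mkcondr /=; apply: ler_sum => W' _.
  case: ifPn => [_|/negPn/covers_fragment -> /=]; last by rewrite mulr0.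
  by rewrite ler_piMr ?random_sub_weight_ge0 //; case: covers.
rewrite (eq_bigr (fun W => w p D W * (1 - mass mu + b) +
   w p D W * \sum_(S | (t < #|fragment mu S W|)%N) mu S)); last by move=> W _;
     ring.
rewrite big_split /= -mulr_suml sum_random_sub_weight mul1r.
have := large_fragments t.+1 p0 p1 q0 qp hmu; lra.
Qed.

(** All the mass sits on the empty set: either it is positive and failure is impossible, or it is
    zero and the bound is trivial. *)
Lemma fail_size0 p q D mu : 0 <= p <= 1 -> spread_weight q D 0 mu ->
  fail p D mu <= 1 - mass mu.
Proof.
move=> hp hmu; have [mu0 muD _] := hmu; have m1 := spread_weight_mass_le1 hmu.
have E : mass mu = mu finset.set0.
  rewrite /mass (bigD1 finset.set0) //= big1 ?addr0 // => S S0.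
  apply/eqP; apply: contraNT S0 => /muD /andP[_].
  by rewrite leqn0 cards_eq0.
case: (eqVneq (mu finset.set0) 0) => [m0|nz].
  by rewrite E m0 subr0 random_sub_prob_le1.
rewrite /fail /random_sub_prob big_pred0; first by lra.
move=> W; rewrite /= andbC; apply/negP => /andP[/existsP[]].
by exists finset.set0; rewrite nz finset.sub0set.
Qed.

(** Each round of density [p1] halves the size, from 2t to t = 2^(i0 + j), with error at most 2^(2t)
    (1/8)^t = 2^-t. Sizes below 2^i0 would make these errors too large, so a single round of density
    [p2] finishes from there. *)
Lemma fail_rounds p1 p2 q D i0 i mu :
  0 < p1 -> p1 < 1 -> 0 < p2 -> p2 < 1 -> 0 <= q -> 8 * q <= p1 -> q <= p2 ->
  spread_weight q D (2 ^ (i0 + i)) mu ->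
  fail (1 - (1 - p1) ^+ i * (1 - p2)) D mu <=
    1 - mass mu + \sum_(j < i) 2^-1 ^+ (i0 + j) + 2 ^+ (2 ^ i0) * (q / p2).
Proof.
move=> p10 p11 p20 p21 q0 qp1 qp2.
elim: i mu => [|i IHi] mu.
  rewrite addn0 expr0 mul1r big_ord0 addr0 => hmu.
  (* Target size 0: the remaining set to expose may have density 0, by [fail_size0]. *)
  have := @fail_step p2 0 q D (2 ^ i0) 0 mu 0 p20 (ltW p21).
  rewrite subr0 mulr1 expr1 addr0; apply=> //; first by rewrite lexx ler01.
  by move=> nu hnu; rewrite addr0; apply: fail_size0 hnu; rewrite lexx ler01.
rewrite addnS expnS => hmu.
have hi : 0 <= 1 - (1 - p1) ^+ i * (1 - p2) <= 1.
  have a0 : 0 <= (1 - p1) ^+ i by rewrite exprn_ge0 // subr_ge0 ltW.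
  have a1 : (1 - p1) ^+ i <= 1 by rewrite exprn_ile1 //; lra.
  have : 0 <= (1 - p1) ^+ i * (1 - p2) <= 1.
    by rewrite mulr_ge0 ?mulr_ile1 //; lra.
  lra.
have IH nu (hnu : spread_weight q D (2 ^ (i0 + i)) nu) :
    fail (1 - (1 - p1) ^+ i * (1 - p2)) D nu <=
     1 - mass nu + (\sum_(j < i) 2^-1 ^+ (i0 + j) + 2 ^+ (2 ^ i0) * (q / p2)).
  by rewrite addrA; exact: IHi.
have qp1' : q <= p1 by lra.
have := fail_step p10 (ltW p11) hi q0 qp1' hmu IH.
rewrite subKr mulrA -exprS => /le_trans; apply; rewrite big_ord_recr /=.
suff : 2 ^+ (2 * 2 ^ (i0 + i)) * (q / p1) ^+ (2 ^ (i0 + i)).+1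
    <= 2^-1 ^+ (i0 + i) :> R by lra.
have x0 : 0 <= q / p1 by rewrite divr_ge0 // ltW.
have x8 : q / p1 <= 8^-1 by rewrite ler_pdivrMr //; lra.
apply: (@le_trans _ _ (2 ^+ (2 * 2 ^ (i0 + i)) * (8^-1) ^+ (2 ^ (i0 + i)))).
  rewrite ler_wpM2l ?exprn_ge0 //;
    apply: (@le_trans _ _ ((q / p1) ^+ (2 ^ (i0 + i)))).
    by rewrite exprS ler_piMl ?exprn_ge0 //; lra.
  by rewrite lerXn2r ?nnegrE //; lra.
rewrite exprM -exprMn (_ : 2 ^+ 2 * 8^-1 = 2^-1 :> R); last by field.
by apply: ler_wiXn2l; [lra|lra|rewrite ltnW // ltn_expl].
Qed.

End SpreadWeights.

(** * Switching blocks of a random placement *)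

Lemma card_bigcup_le (I T : finType) (P : pred I) (F : I -> {set T}) :
  (#|\bigcup_(i | P i) F i| <= \sum_(i | P i) #|F i|)%N.
Proof.
elim/big_rec2: _ => [|i n S _ le]; first by rewrite cards0.
by rewrite (leq_trans (leq_card_setU _ _).1) // leq_add2l.
Qed.

Section Switching.
Local Open Scope nat_scope.
Variables (V : finType) (N m' : nat).
Local Notation m := m'.+1.
Local Notation pos := ('I_N * 'I_m)%type.
Local Notation choice := ({ffun 'I_m -> 'I_N} * {ffun 'I_m -> 'I_m})%type.
Implicit Types (f : {ffun pos -> V}) (b : 'I_N) (c : choice) (a : 'I_m.+1).
Implicit Types (U : {set 'I_N}) (A X : {set V}).

Definition block f b : {set V} := [set f (b, i) | i : 'I_m].

Definition placement A f : bool := injectiveb f && [forall x, f x \in A].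

(* A choice c selects m partner blocks of b and a cyclic shift inside each.   *)
(* The m + 1 blocks involved are indexed by Z/(m+1), with b at index 0.       *)
Definition partner b c a : 'I_N := if unlift ord0 a is Some j then c.1 j else b.

Definition shift c a : 'I_m := if unlift ord0 a is Some j then c.2 j else ord0.

(** [lift ord0 i] runs over the nonzero residues modulo m + 1, so slot i of block a is filled from
    block a + (i + 1), never from a itself. The entry taken there is i rotated by that block's
    shift; [b] is not rotated. *)
Definition transversal_pos b c a (i : 'I_m) : pos :=
  (partner b c (a + lift ord0 i)%R, (i + shift c (a + lift ord0 i))%R).

Definition relocate b c (x : pos) : pos :=
  if [pick a | partner b c a == x.1] is Some a then transversal_pos b c a x.2
  else x.

(* After the switch the block of index a holds exactly one vertex from each   *)
(* block of index different from a, and none of its own.                      *)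
Definition switch b c f : {ffun pos -> V} := [ffun x => f (relocate b c x)].

(** [U] collects the blocks which the partners must avoid: [b] itself and the blocks holding
    prescribed vertices. *)
Definition valid U c : bool := injectiveb c.1 && [forall j, c.1 j \notin U].

Lemma partner0 b c : partner b c ord0 = b.
Proof. by rewrite /partner unlift_none. Qed.

Lemma partner_lift b c j : partner b c (lift ord0 j) = c.1 j.
Proof. by rewrite /partner liftK. Qed.

Lemma shift_lift c j : shift c (lift ord0 j) = c.2 j.
Proof. by rewrite /shift liftK. Qed.

Lemma partner_inj b U c : b \in U -> valid U c -> injective (partner b c).
Proof.
move=> bU /andP[/injectiveP injc /forallP cU] a a'; rewrite /partner.
case: unliftP => [j ->|->]; case: unliftP => [j' ->|->] //.
- by move/injc ->.
- by move=> E; have := cU j; rewrite E bU.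
- by move=> E; have := cU j'; rewrite -E bU.
Qed.

Lemma shifted_pos_inj (p p' : 'I_N) (i s s' : 'I_m) :
  (p, (i + s)%R) = (p', (i + s')%R) -> p = p' /\ s = s'.
Proof.
by move=> E; split; [have := congr1 fst E | have /GRing.addrI := congr1 snd E].
Qed.

Lemma transversal_pos_inj b c a a' i i' : injective (partner b c) ->
  transversal_pos b c a i = transversal_pos b c a' i' -> (a, i) = (a', i').
Proof.
move=> inj E; have /inj/= E1 := congr1 fst E; move: (congr1 snd E);
  rewrite /= E1.
by move/GRing.addIr => Ei; rewrite Ei in E1 *; move/GRing.addIr: E1 => ->.
Qed.

Lemma relocate_in b c a i : injective (partner b c) ->
  relocate b c (partner b c a, i) = transversal_pos b c a i.
Proof.
move=> inj; rewrite /relocate; case: pickP => [a' /eqP/inj -> //|/(_ a)].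
by rewrite eqxx.
Qed.

Lemma relocate_out b c x : (forall a,
  partner b c a != x.1) -> relocate b c x = x.
Proof.
by move=> out; rewrite /relocate; case: pickP => // a; rewrite (negPf (out a)).
Qed.

Variant relocate_spec b c (x : pos) : Prop :=
| RelocateIn a i of x = (partner b c a, i)
| RelocateOut of forall a, partner b c a != x.1.

Lemma relocateP b c x : relocate_spec b c x.
Proof.
case: (pickP (fun a => partner b c a == x.1)) => [a /eqP E|out].
  by apply: (@RelocateIn _ _ _ a x.2); rewrite E; case: x {E}.
by apply: RelocateOut => a; rewrite out.
Qed.

Lemma relocate_inj b c : injective (partner b c) -> injective (relocate b c).
Proof.
move=> inj x y; case: (relocateP b c x) => [a i ->|outx];
  case: (relocateP b c y) => [a' i' ->|outy].
- by rewrite !relocate_in // => /(transversal_pos_inj inj) [-> ->].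
- rewrite relocate_in // (relocate_out outy) => E.
  by have := outy (a + lift ord0 i)%R; rewrite -E eqxx.
- rewrite relocate_in // (relocate_out outx) => E.
  by have := outx (a' + lift ord0 i')%R; rewrite E eqxx.
- by rewrite !relocate_out.
Qed.

Lemma switch_inj b c : injective (partner b c) -> injective (switch b c).
Proof.
move=> /relocate_inj inj f f' E; apply/ffunP => x.
have [g _ gK] := injF_bij inj.
by rewrite -(gK x); have /ffunP/(_ (g x)) := E; rewrite !ffunE.
Qed.

Lemma placement_switch A b c f : injective (partner b c) ->
  placement A f -> placement A (switch b c f).
Proof.
move=> /relocate_inj inj /andP[/injectiveP injf /forallP fA].
apply/andP; split; last by apply/forallP => x; rewrite ffunE.
by apply/injectiveP => x y; rewrite !ffunE => /injf/inj.
Qed.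

Definition new_row b c f a : {ffun 'I_m -> V} :=
  [ffun i => f (transversal_pos b c a i)].

Lemma block_switch_in b c f a : injective (partner b c) ->
  block (switch b c f) (partner b c a) = [set new_row b c f a i | i : 'I_m].
Proof.
by move=> inj; apply: eq_imset => i; rewrite !ffunE relocate_in.
Qed.

Lemma block_switch_out b c f b' : (forall a, partner b c a != b') ->
  block (switch b c f) b' = block f b'.
Proof.
by move=> out; apply: eq_imset => i; rewrite ffunE relocate_out.
Qed.

Variables (A : {set V}) (good : pred {set V}) (K : nat).
Hypothesis cardA : #|A| = N * m.

Definition bad_rows (i0 : 'I_m) (v : V) : {set {ffun 'I_m -> V}} :=
  [set x : {ffun 'I_m -> V} | [&& injectiveb x, [forall i, x i \in A], x i0 == v
     & ~~ good [set x i | i : 'I_m]]].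

Hypothesis few_bad : forall i0 v, v \in A -> #|bad_rows i0 v| <= K.
Hypothesis K_small : 8 * m * K <= (N * m) ^ m'.

Definition good_choices b U f : {set choice} :=
  [set c | valid U c & [forall a, good (block (switch b c f) (partner b c a))]].

Lemma new_row_inj b U c f a : b \in U -> valid U c -> placement A f ->
  injective (new_row b c f a).
Proof.
move=> bU cU /andP[/injectiveP injf _] i i'; rewrite !ffunE => /injf.
by move/(transversal_pos_inj (partner_inj bU cU)) => [].
Qed.

(** A vertex of the new row reveals the partner and shift of the block it comes from, by injectivity
    of [f]. For a nonzero, only index a is not revealed, which leaves N * m options, while the row
    passes through a vertex of block [b] known in advance, so [few_bad] leaves [K] rows. For a = 0
    the row reveals the whole choice, and its first vertex is one of the N * m elements of [A]. *)
Lemma card_bad_choices b U f a : b \in U -> placement A f ->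
  #|[set c | valid U c & ~~ good (block (switch b c f) (partner b c a))]|
    <= K * (N * m).
Proof.
move=> bU fP; have /andP[/injectiveP injf /forallP fA] := fP.
set B := [set c | _ & _].
have rowB i0 c : c \in B ->
    new_row b c f a \in bad_rows i0 (new_row b c f a i0).
  rewrite !inE => /andP[cU bad]; apply/and4P; split=> //.
  - exact/injectiveP/(new_row_inj bU cU fP).
  - by apply/forallP => i; rewrite ffunE.
  by rewrite -block_switch_in //; exact: partner_inj bU cU.
have rowE c i d : (a + lift ord0 i)%R = lift ord0 d ->
    new_row b c f a i = f (c.1 d, (i + c.2 d)%R).
  by move=> E; rewrite ffunE /transversal_pos E partner_lift shift_lift.
case: (unliftP ord0 a) => [j0|] Ea.
  case: (unliftP ord0 (- a)%R) => [i0|] Ei0; last first.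
    have : a = ord0 by rewrite -[a]opprK Ei0 oppr0.
    by rewrite Ea => /eqP; rewrite eq_sym (negPf (neq_lift _ _)).
  pose g c := (new_row b c f a, (c.1 j0, c.2 j0)).
  have injg : {in B &, injective g}.
    move=> c c' _ _ [Erow E1 E2].
    suff Ej j : c.1 j = c'.1 j /\ c.2 j = c'.2 j.
      by case: c c' {Erow E1 E2} Ej => c1 c2 [c1' c2'] /= Ej; congr pair;
        apply/ffunP => j; have [] := Ej j.
    case: (eqVneq j j0) => [->//|jj0].
    case: (unliftP ord0 (lift ord0 j - a)%R) => [i|] Ei; last first.
      have : lift ord0 j = a.
        by apply/eqP; rewrite -subr_eq0 Ei.
      by rewrite Ea => /lift_inj E; rewrite E eqxx in jj0.
    have Eai : (a + lift ord0 i)%R = lift ord0 j by rewrite -Ei addrC subrK.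
    have /ffunP/(_ i) := Erow; rewrite !(rowE _ _ _ Eai) =>
      /injf/shifted_pos_inj[-> ->].
    by [].
  rewrite -(card_in_imset injg).
  apply: (@leq_trans #|finset.setX (bad_rows i0 (f (b, i0))) [set: pos]|).
    apply: subset_leq_card; apply/fintype.subsetP => _ /imsetP[c cB ->].
    rewrite finset.in_setX finset.in_setT andbT; have := rowB i0 c cB.
    rewrite [X in _ \in bad_rows _ X]ffunE /transversal_pos -Ei0 subrr.
    by rewrite partner0 /shift unlift_none addr0.
  rewrite cardsX cardsT card_prod !card_ord leq_mul2r few_bad ?orbT //.
have injg : {in B &, injective (fun c => new_row b c f a)}.
  move=> c c' _ _ /ffunP Erow.
  have Ej j : c.1 j = c'.1 j /\ c.2 j = c'.2 j.
    have Eai : (a + lift ord0 j)%R = lift ord0 j by rewrite Ea add0r.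
    by have := Erow j; rewrite !(rowE _ _ _ Eai) =>
      /injf/shifted_pos_inj[-> ->].
  by case: c c' {Erow} Ej => c1 c2 [c1' c2'] /= Ej; congr pair;
    apply/ffunP => j; have [] := Ej j.
rewrite -(card_in_imset injg).
apply: (@leq_trans #|\bigcup_(v in A) bad_rows ord0 v|).
  apply: subset_leq_card; apply/fintype.subsetP => _ /imsetP[c cB ->].
  apply/finset.bigcupP; exists (new_row b c f a ord0); last exact: rowB.
  by rewrite ffunE.
apply: leq_trans (card_bigcup_le _ _) _.
apply: (@leq_trans (\sum_(v in A) K)).
  by apply: leq_sum => v vA; exact: few_bad.
by rewrite sum_nat_const cardA mulnC.
Qed.

Lemma card_valid U : #|[set c | valid U c]| = (N - #|U|) ^_ m * m ^ m.
Proof.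
pose G := [set g in ffun_on (mem (~: U))
  | injectiveb (g : {ffun 'I_m -> 'I_N})].
have -> : [set c | valid U c] = finset.setX G [set: {ffun 'I_m -> 'I_m}].
  apply/setP => [[g t]]; rewrite !inE /valid /= andbT andbC; congr (_ && _).
  by apply/forallP/ffun_onP => /= H j; have := H j; rewrite !inE.
rewrite cardsX cardsT card_ffun card_ord; congr (_ * _).
by rewrite card_inj_ffuns_on card_ord [#|mem (~: U)|]cardsCs finset.setCK card_ord.
Qed.

(** Of the (N * m)^m choices at least 3/4 are valid, and the m + 1 new blocks spoil at most 1/4,
    because 4(m + 1) <= 8m. *)
Lemma card_good_choices b U f : b \in U -> placement A f ->
  3 * N ^ m <= 4 * (N - #|U|) ^_ m -> (N * m) ^ m <= 2 * #|good_choices b U f|.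
Proof.
move=> bU fP NU.
pose Bad a := [set c | valid U c & ~~ good (block (switch b c f)
  (partner b c a))].
have : #|[set c | valid U c]| <= #|good_choices b U f| + #|\bigcup_a Bad a|.
  apply: leq_trans (leq_card_setU _ _).1; apply: subset_leq_card.
  apply/fintype.subsetP => c; rewrite !inE => cU; rewrite cU /=.
  case: (boolP [forall a, _]) => //= /forallPn[a bad].
  by apply/finset.bigcupP; exists a => //; rewrite inE cU.
have : #|\bigcup_a Bad a| <= m.+1 * (K * (N * m)).
  apply: leq_trans (card_bigcup_le _ _) _.
  apply: (@leq_trans (\sum_(a : 'I_m.+1) K * (N * m))).
    by apply: leq_sum => a _; exact: card_bad_choices.
  by rewrite sum_nat_const card_ord.
rewrite card_valid; move: NU.
have : 8 * m * K * (N * m) <= (N * m)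
  ^ m by rewrite [leqRHS]expnSr leq_mul2r K_small orbT.
rewrite expnMn; move: (N ^ m) (m ^ m) ((N - #|U|) ^_ m) #|good_choices b U f|.
move: #|\bigcup_a Bad a| => bd x y z g H1 H2 H3 H4.
have : 3 * (x * y) <= 4 * (z * y) by rewrite !mulnA leq_mul2r H2 orbT.
have : 4 * (m.+1 * (K * (N * m))) <= 8 * m * K * (N * m).
  by rewrite !mulnA !leq_mul2r; lia.
by lia.
Qed.

Definition arrangements X (h : V -> pos) : {set {ffun pos -> V}} :=
  [set f | [&& placement A f, [forall b, good (block f b)]
    & [forall v in X, f (h v) == v]]].

(** Count pairs (arrangement, good choice) by their switched image. A switch at [b] avoids the other
    prescribed blocks and scatters the vertices of [Xb] over |Xb| partners. From the image these
    partners can be read off, so at most N^(m - |Xb|) * m^m choices lead to it, against half of N^m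
    * m^m choices available at the start. *)
Lemma arrangements_step X (h : V -> pos) b :
  let U := [set (h v).1 | v in X] in let Xb := [set v in X | (h v).1 == b] in
  b \in U -> 3 * N ^ m <= 4 * (N - #|U|) ^_ m ->
  #|arrangements X h| * N ^ #|Xb| <= 2 * #|arrangements (X :\: Xb) h|.
Proof.
move=> U Xb bU NU; have N0 : 0 < N := leq_ltn_trans (leq0n b) (ltn_ord b).
case: (set_0Vmem (arrangements X h)) => [->|[f0]]; first by rewrite cards0.
rewrite inE => /and3P[/andP[/injectiveP injf0 _] _ /forall_inP hf0].
have hinj : {in X &, injective h}.
  by move=> v v' /hf0/eqP E /hf0/eqP E' hE; rewrite -E -E' hE.
have hXb v : v \in Xb -> (v \in X) /\ h v = (b, (h v).2).
  by rewrite inE => /andP[vX /eqP <-]; case: (h v).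
pose io (i : 'I_m) : 'I_m := odflt i (unlift ord0 (- lift ord0 i)%R).
have ioE i : lift ord0 (io i) = (- lift ord0 i)%R :> 'I_m.+1.
  rewrite /io; case: (unliftP ord0 (- lift ord0 i)%R) => [j -> //|/eqP].
  by rewrite oppr_eq0 eq_sym (negPf (neq_lift _ _)).
have io_inj : injective io.
  move=> i i' E; apply: (@lift_inj _ ord0); apply: (@oppr_inj _).
  by rewrite -!ioE E.
pose J := [set io (h v).2 | v in Xb].
have cardJ : #|J| = #|Xb|.
  rewrite card_in_imset // => v v' vX v'X /io_inj E.
  have [vX' hv] := hXb v vX; have [v'X' hv'] := hXb v' v'X.
  by apply: hinj => //; rewrite hv hv' E.
have Xm : #|Xb| <= m by rewrite -cardJ (leq_trans (max_card _)) ?card_ord.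
pose P := [set fc : {ffun pos -> V} * choice |
  (fc.1 \in arrangements X h) && (fc.2 \in good_choices b U fc.1)].
have cardP : #|arrangements X h| * (N * m) ^ m <= 2 * #|P|.
  rewrite -[#|P|]sum1_card (eq_bigl (fun fc => (fc.1 \in arrangements X h) &&
    (fc.2 \in good_choices b U fc.1))); last by move=> fc; rewrite inE.
  rewrite -(pair_big_dep (mem (arrangements X h)) (fun f c =>
    c \in good_choices b U f) (fun _ _ => 1)) /=.
  rewrite big_distrr /= -sum_nat_const; apply: leq_sum => f; rewrite inE =>
    /andP[fP _].
  by rewrite sum1_card card_good_choices.
pose phi (fc : {ffun pos -> V} * choice) := (switch b fc.2 fc.1, fc.2).
have injphi : {in P &, injective phi}.
  move=> [f c] [f' c']; rewrite !inE /= => /andP[_ /andP[cU _]] _ E.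
  have E2 : c = c' := congr1 snd E; have := congr1 fst E; rewrite /= -E2.
  by move/(switch_inj (partner_inj bU cU)) ->.
pose Q (f' : {ffun pos -> V}) : {set choice} :=
  [set c : choice | [forall v in Xb, f' (c.1 (io (h v).2), (h v).2) == v]].
have PQ : phi @: P \subset [set fc : {ffun pos -> V} * choice |
   (fc.1 \in arrangements (X :\: Xb) h) && (fc.2 \in Q fc.1)].
  apply/fintype.subsetP => _ /imsetP[[f c] + ->]; rewrite !inE /=.
  move=> /andP[/and3P[fP /forallP fgood /forall_inP fX]
    /andP[cU /forallP cgood]].
  have pinj := partner_inj bU cU; rewrite placement_switch //=.
  apply/andP; split; [apply/andP; split|].
  - apply/forallP => b'; case: (pickP (fun a => partner b c a == b')) =>
    [a /eqP <- //|out].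
    by rewrite block_switch_out // => a; rewrite out.
  - apply/forall_inP => v; rewrite !inE => /andP[+ vX]; rewrite vX /= => hvb.
    rewrite ffunE relocate_out ?fX // => a; rewrite /partner.
    case: unliftP => [j _|_]; last by rewrite eq_sym.
    have /andP[_ /forallP/(_ j)] := cU; apply: contraNneq => ->.
    exact: imset_f.
  apply/forall_inP => v vX; have [vX' hv] := hXb v vX.
  rewrite -(partner_lift b) ioE ffunE relocate_in // /transversal_pos addNr.
  by rewrite partner0 /shift unlift_none addr0 -hv fX.
have cardQ f' : injective f' -> #|Q f'| <= N ^ (m - #|Xb|) * m ^ m.
  move=> injf'.
  pose r (c : choice) := ([ffun j : {j | j \notin J} => c.1 (val j)], c.2).
  have injr : {in Q f' &, injective r}.
    move=> [c1 c2] [c1' c2']; rewrite !inE =>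
      /forall_inP /= cQ /forall_inP /= c'Q E.
    have E2 : c2 = c2' := congr1 snd E; rewrite E2; congr pair; apply/ffunP =>
      j.
    case: (boolP (j \in J)) => [/imsetP[v vX ->]|jJ].
      have := cQ v vX; rewrite -[in X in _ == X](eqP (c'Q v vX)) => /eqP/injf'.
      exact: (congr1 fst).
    by have /ffunP/(_ (exist _ j jJ)) := congr1 fst E; rewrite !ffunE.
  rewrite -(card_in_imset injr); apply: leq_trans (max_card _) _.
  rewrite card_prod !card_ffun !card_ord card_sig -cardJ leq_mul2r; apply/orP;
    right.
  rewrite leq_pexp2l //.
  rewrite -[m in _ <= m - _]card_ord -(cardC (mem J)) addKn.
  by rewrite leq_eqVlt; apply/orP; left; apply/eqP/eq_card.
have : #|P| <= #|arrangements (X :\: Xb) h| * (N ^ (m - #|Xb|) * m ^ m).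
  rewrite -(card_in_imset injphi); apply: leq_trans (subset_leq_card PQ) _.
  rewrite -[X in X <= _]sum1_card (eq_bigl (fun fc : {ffun pos -> V} * choice =>
    (fc.1 \in arrangements (X :\: Xb) h) && (fc.2 \in Q fc.1)));
    last by move=> fc; rewrite inE.
  rewrite -(pair_big_dep (mem (arrangements (X :\: Xb) h)) (fun f c =>
    c \in Q f)
    (fun _ _ => 1)) /=.
  rewrite -sum_nat_const; apply: leq_sum => f.
  by rewrite inE sum1_card => /and3P[/andP[/injectiveP injf _] _ _];
    exact: cardQ.
move: cardP; move: #|P| #|arrangements _ _| #|arrangements _ _| => p B C H1 H2.
have z0 : 0 < N ^ (m - #|Xb|) * m ^ m by rewrite muln_gt0 !expn_gt0 N0.
rewrite -(leq_pmul2r z0) -mulnA [N ^ _ * _]mulnA -expnD subnKC // -expnMn.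
by rewrite (leq_trans H1) // -mulnA leq_mul2l.
Qed.

Lemma leq_ffact n1 n2 k : n1 <= n2 -> n1 ^_ k <= n2 ^_ k.
Proof. by move=> le; rewrite !ffact_prod; apply: leq_prod => i _;
  exact: leq_sub2r. Qed.

Lemma arrangements0 (h h' : V -> pos) :
  arrangements finset.set0 h = arrangements finset.set0 h'.
Proof.
apply/setP => f; rewrite !inE; congr [&& _, _ & _].
by apply/forall_inP/forall_inP => _ v; rewrite inE.
Qed.

(** Release the prescribed vertices one block at a time; each step costs a factor 2 and releases at
    least one vertex. *)
Lemma arrangements_few X (h : V -> pos) :
  3 * N ^ m <= 4 * (N - #|X|) ^_ m ->
  #|arrangements X h| * N ^ #|X| <= 2 ^ #|X| * #|arrangements finset.set0 h|.
Proof.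
elim: {X}#|X| {-2}X (leqnn #|X|) => [|n IHn] X.
  by rewrite leqn0 cards_eq0 => /eqP -> _; rewrite cards0 muln1 mul1n.
move=> Xn NX; case: (set_0Vmem X) => [->|[v vX]].
  by rewrite cards0 muln1 mul1n.
set b := (h v).1; pose Xb := [set v in X | (h v).1 == b].
have UX : #|[set (h v).1 | v in X]| <= #|X| := leq_imset_card _ _.
have NU : 3 * N ^ m <= 4 * (N - #|[set (h v).1 | v in X]|) ^_ m.
  by rewrite (leq_trans NX) // leq_mul2l leq_ffact // leq_sub2l.
have := arrangements_step (imset_f (fun v => (h v).1) vX) NU;
  rewrite -/b -/Xb => H.
have XbX : Xb \subset X by apply/fintype.subsetP => u; rewrite inE => /andP[].
have Xb0 : 0 < #|Xb| by apply/card_gt0P; exists v; rewrite inE vX /=.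
have cX : #|X :\: Xb| + #|Xb| = #|X| by rewrite cardsDS // subnK //
  subset_leq_card.
have {}IH : #|arrangements (X :\: Xb) h| * N ^ #|X :\: Xb|
    <= 2 ^ #|X :\: Xb| * #|arrangements finset.set0 h|.
  apply: IHn; first by lia.
  by rewrite (leq_trans NX) // leq_mul2l leq_ffact // leq_sub2l // -cX leq_addr.
have x2 : 2 <= 2 ^ #|Xb| by rewrite -[X in X <= _]expn1 leq_pexp2l.
rewrite -cX !expnD; move: H IH x2.
move: (N ^ #|Xb|) (N ^ #|X :\: Xb|) (2 ^ #|Xb|) (2 ^ #|X :\: Xb|)
  #|arrangements X h|.
move: #|arrangements (X :\: Xb) h| #|arrangements finset.set0 h|.
move=> B C x y z t A0 H1 H2 H3; rewrite mulnCA mulnC.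
rewrite (leq_trans (leq_mul H1 (leqnn y))) // -mulnA.
by rewrite (leq_trans (leq_mul H3 H2)) // mulnA (mulnC z).
Qed.

(** * Repairing the bad blocks of an arbitrary placement *)

Definition bad_blocks f : nat := #|[set b | ~~ good (block f b)]|.

Definition bad_at_most j : {set {ffun pos -> V}} :=
  [set f | placement A f && (bad_blocks f <= j)].

(* A switch at a bad block lowers the number of bad blocks, and its outcome   *)
(* together with the block and the choice determines the original placement.  *)
Lemma repair_step j : 3 * N ^ m <= 4 * (N.-1) ^_ m -> j < N ->
  j.+1 * #|bad_at_most j.+1| <= 3 * N * #|bad_at_most j|.
Proof.
move=> NU jN; have N0 : 0 < N by exact: leq_ltn_trans jN.
pose E := [set f | placement A f && (bad_blocks f == j.+1)].
have cE : #|bad_at_most j.+1| <= #|bad_at_most j| + #|E|.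
  apply: leq_trans (leq_card_setU _ _).1; apply: subset_leq_card.
  apply/fintype.subsetP => f; rewrite !inE => /andP[-> ];
    rewrite leq_eqVlt ltnS.
  by case/orP => ->; rewrite ?orbT.
(* The placements with at most j bad blocks contribute another factor j + 1 <= N, and N + 2N =
   3N. *)
suff HE : j.+1 * #|E| <= 2 * N * #|bad_at_most j|.
  apply: leq_trans (leq_mul (leqnn _) cE) _; rewrite mulnDr.
  apply: (leq_trans (leq_add (leq_mul jN (leqnn _)) HE)).
  by rewrite -mulnDl -mulSn.
pose P := [set x : {ffun pos -> V} * ('I_N * choice) |
  (x.1 \in E) && (~~ good (block x.1 x.2.1) &&
     (x.2.2 \in good_choices x.2.1 [set x.2.1] x.1))].
have cP : j.+1 * #|E| * (N * m) ^ m <= 2 * #|P|.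
  rewrite -[#|P|]sum1_card (eq_bigl (fun x : {ffun pos -> V} * ('I_N * choice)
    =>
    (x.1 \in E) && (~~ good (block x.1 x.2.1) &&
     (x.2.2 \in good_choices x.2.1 [set x.2.1] x.1)))); last by move=> x;
       rewrite inE.
  rewrite -(pair_big_dep (mem E) (fun f (y : 'I_N * choice) =>
    ~~ good (block f y.1) &&
     (y.2 \in good_choices y.1 [set y.1] f)) (fun _ _ => 1)) /=.
  rewrite big_distrr /= mulnAC mulnC -sum_nat_const; apply: leq_sum => f.
  rewrite inE => /andP[fP /eqP bf].
  rewrite -(pair_big_dep (fun b => ~~ good (block f b)) (fun b c =>
     c \in good_choices b [set b] f) (fun _ _ => 1)) /=.
  rewrite big_distrr /= -bf /bad_blocks -sum_nat_const.
  rewrite [leqLHS](eq_bigl (fun b => ~~ good (block f b))) /=; last by move=>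
    b; rewrite inE.
  apply: leq_sum => b _; rewrite sum1_card card_good_choices ?set11 //.
  by rewrite cards1 subn1.
pose phi (x : {ffun pos -> V} * ('I_N * choice)) := (switch x.2.1 x.2.2 x.1,
  x.2).
have injphi : {in P &, injective phi}.
  move=> [f [b c]] [f' [b' c']]; rewrite !inE /= =>
    /and3P[_ _ /andP[cU _]] _ Eq.
  have [Eb Ec] : b = b' /\ c = c' by have := congr1 snd Eq => -[-> ->].
  have := congr1 fst Eq; rewrite /= -Eb -Ec.
  by move/(switch_inj (partner_inj (set11 b) cU)) ->.
have PQ : phi @: P \subset finset.setX (bad_at_most j) finset.setT.
  apply/fintype.subsetP => _ /imsetP[[f [b c]] + ->]; rewrite !inE /= andbT.
  move=> /and3P[/andP[fP /eqP bf] fb /andP[cU /forallP cgood]].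
  have pinj := partner_inj (set11 b) cU; rewrite placement_switch //=.
  rewrite -ltnS -bf; apply: proper_card; apply/fintype.properP; split.
    apply/fintype.subsetP => b'; rewrite !inE; apply: contra => fb'.
    case: (pickP (fun a => partner b c a == b')) => [a /eqP <- //|out].
    by rewrite block_switch_out // => a; rewrite out.
  exists b; rewrite !inE ?fb // negbK.
  by have := cgood ord0; rewrite partner0.
have : #|P| <= #|bad_at_most j| * (N * (N ^ m * m ^ m)).
  rewrite -(card_in_imset injphi); apply: leq_trans (subset_leq_card PQ) _.
  by rewrite cardsX cardsT !card_prod !card_ffun !card_ord.
move: cP; rewrite -expnMn.
have z0 : 0 < (N * m) ^ m by rewrite expn_gt0 muln_gt0 N0.
move=> H1 H2; rewrite -(leq_pmul2r z0) (leq_trans H1) //.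
by rewrite -!mulnA leq_mul2l /= (leq_trans H2) // mulnCA.
Qed.

(** Iterate [repair_step] from j = N, where all (N * m)! placements are counted, down to j = 0; the
    factors j + 1 multiply to N!. *)
Lemma repair : 3 * N ^ m <= 4 * (N.-1) ^_ m ->
  (N * m)`! * N`! <= (3 * N) ^ N * #|bad_at_most 0|.
Proof.
move=> NU; have H j : j <= N -> j`! * #|bad_at_most j| <=
  (3 * N) ^ j * #|bad_at_most 0|.
  elim: j => [|j IHj] jN; first by rewrite fact0 expn0.
  rewrite factS mulnC mulnA (mulnC _ j.+1) expnS.
  rewrite (leq_trans (leq_mul (repair_step NU jN) (leqnn _))) //.
  by rewrite -!mulnA leq_mul2l leq_mul2l mulnC IHj ?orbT // ltnW.
apply: leq_trans (H N (leqnn N)); rewrite mulnC leq_mul2l.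
apply/orP; right; rewrite -ffactnn.
have {1}<- : #|A| = N * m := cardA.
have <- : #|{: pos}| = N * m by rewrite card_prod !card_ord.
rewrite -card_inj_ffuns_on; apply: subset_leq_card; apply/fintype.subsetP => f.
rewrite !inE => /andP[/ffun_onP fA finj]; rewrite /placement finj /=.
apply/andP; split; first by apply/forallP.
by rewrite /bad_blocks (leq_trans (max_card _)) // card_ord.
Qed.

Lemma bad_at_most0 h : bad_at_most 0 = arrangements finset.set0 h.
Proof.
apply/setP => f; rewrite !inE leqn0 cards_eq0; congr (_ && _).
apply/eqP/andP => [/setP E|[/forallP fg _]].
  split; apply/forallP => b; first by have := E b; rewrite !inE => /negbFE.
  by rewrite inE.
by apply/setP => b; rewrite !inE fg.
Qed.

End Switching.

(** * Estimates for powers and falling factorials *)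

Lemma expn_sub_bound a n m : (a <= n)%N -> (n ^ m <=
  a ^ m + m * (n - a) * n ^ m.-1)%N.
Proof.
move=> an; rewrite -leq_subLR subn_exp -mulnA mulnCA leq_mul2l; apply/orP;
  right.
rewrite -[X in (_ <= X * _)%N]card_ord -sum_nat_const; apply: leq_sum => i _.
have -> : (m.-1 = (m.-1 - i) + i)%N by rewrite subnK //
  -ltnS (ltn_predK (ltn_ord i)).
rewrite expnD addnK leq_mul2l; apply/orP; right.
by case: (nat_of_ord i) => // j; rewrite leq_exp2r.
Qed.

Lemma ffact_large N u m : (4 * m * (u + m) <= N)%N ->
  (3 * N ^ m <= 4 * (N - u) ^_ m)%N.
Proof.
case: m => [|m] le; first by [].
have uN : (u + m.+1 <= N)%N by apply: leq_trans le; rewrite leq_pmull //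
  muln_gt0.
apply: (@leq_trans (4 * (N - (u + m.+1)) ^ m.+1)%N); last first.
  rewrite leq_mul2l /= ffact_prod -[X in (_ ^ X)%N]card_ord -prod_nat_const.
  by apply: leq_prod => i _; rewrite -subnDA leq_sub2l // leq_add2l ltnW.
have := expn_sub_bound m.+1 (leq_subr (u + m.+1) N).
rewrite subKn // => /(leq_mul (leqnn 4)); rewrite mulnDr => H.
suff : (4 * (m.+1 * (u + m.+1) * N ^ m) <= N ^ m.+1)%N.
  by move: H => /=; move: (N ^ m.+1)%N (_ ^ m.+1)%N (4 * (_ * _ * _))%N; lia.
by rewrite !mulnA expnS leq_mul2r le orbT.
Qed.

Lemma expnn_fact n : (n ^ n <= 4 ^ n * n`!)%N.
Proof.
apply: (@leq_trans ((n + n) ^_ n)).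
  rewrite ffact_prod -[X in (_ ^ X)%N]card_ord -prod_nat_const.
  by apply: leq_prod => i _; rewrite -addnBA ?leq_addr // ltnW.
rewrite -bin_ffact leq_mul2r; apply/orP; right.
have -> : (4 ^ n = 2 ^ (n + n))%N by rewrite expnD -expnMn.
rewrite -[X in (2 ^ X)%N]card_ord -cardsT -card_powerset -[X in ('C(X, _) <=
  _)%N]card_ord -cardsT.
rewrite -cards_draws; apply: subset_leq_card; apply/fintype.subsetP => S.
by rewrite !inE => /andP[].
Qed.

(** Factor by factor, (n - i) / n >= (j - i) / j, which reduces the claim to [expnn_fact] for j. *)
Lemma expn_ffact n j : (j <= n)%N -> (n ^ j <= 4 ^ j * n ^_ j)%N.
Proof.
move=> jn; case: (posnP j) => [->//|j0].
have H : (n ^ j * j`! <= n ^_ j * j ^ j)%N.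
  have E x : (x ^ j = \prod_(i < j) x)%N by rewrite prod_nat_const card_ord.
  rewrite -ffactnn !ffact_prod !E -!big_split /=; apply: leq_prod => i _.
  rewrite mulnBr mulnBl; apply: leq_sub; first by [].
  by rewrite [leqRHS]mulnC leq_mul2l jn orbT.
have := leq_mul (leqnn (n ^_ j)) (expnn_fact j); move/(leq_trans H).
by rewrite mulnCA [(4 ^ j * _)%N]mulnA leq_pmul2r ?fact_gt0.
Qed.

Lemma card_inj_prescribed (S T : finType) (A : {set T}) (Y : {set S})
  (g : S -> T) :
  (#|[set f : {ffun S -> T} | [&& injectiveb f, [forall x, f x \in A]
      & [forall x in Y, f x == g x]]]|
    <= (#|A| - #|Y|) ^_ (#|S| - #|Y|))%N.
Proof.
set F := [set f | _]; case: (set_0Vmem F) => [->|[f0]]; first by rewrite cards0.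
rewrite inE => /and3P[/injectiveP inj0 /forallP A0 /forall_inP Y0].
have injg : {in Y &, injective g}.
  by move=> x y /Y0/eqP <- /Y0/eqP <-; exact: inj0.
have gA : g @: Y \subset A.
  by apply/fintype.subsetP => _ /imsetP[x /Y0/eqP <- ->]; exact: A0.
pose r (f : {ffun S -> T}) := [ffun x : {x | x \notin Y} => f (val x)].
have injr : {in F &, injective r}.
  move=> f f'; rewrite !inE =>
    /and3P[_ _ /forall_inP fY] /and3P[_ _ /forall_inP f'Y] E.
  apply/ffunP => x; case: (boolP (x \in Y)) => xY.
    by rewrite (eqP (fY x xY)) (eqP (f'Y x xY)).
  by have /ffunP/(_ (exist _ x xY)) := E; rewrite !ffunE.
rewrite -(card_in_imset injr).
have -> : (#|A| - #|Y| = #|mem (A :\: g @: Y)|)%N.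
  by rewrite -(card_in_imset injg) -cardsDS.
have -> : (#|S| - #|Y| = #|{: {x | x \notin Y}}|)%N.
  by rewrite card_sig -(cardC (mem Y)) addKn; apply: eq_card.
rewrite -card_inj_ffuns_on; apply: subset_leq_card.
apply/fintype.subsetP => _ /imsetP[f + ->]; rewrite !inE.
move=> /and3P[/injectiveP injf /forallP fA /forall_inP fY]; apply/andP; split.
  apply/ffun_onP => x; rewrite ffunE inE fA andbT.
  apply/imsetP => [[y yY E]]; have /injf E' : f (val x)
    = f y by rewrite E (eqP (fY y yY)).
  by have := valP x; rewrite /= E' yY.
by apply/injectiveP => x y; rewrite !ffunE => /injf/val_inj.
Qed.

(** * Prescribing positions in a random good arrangement *)

Section ArrangementBound.
Local Open Scope nat_scope.
Variables (V : finType) (N m' : nat) (A : {set V}) (good : pred {set V})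
  (K : nat).
Local Notation m := m'.+1.
Local Notation pos := ('I_N * 'I_m)%type.
Hypothesis cardA : #|A| = N * m.
Hypothesis few_bad : forall (i0 : 'I_m) v,
  v \in A -> #|bad_rows A good i0 v| <= K.
Hypothesis K_small : 8 * m * K <= (N * m) ^ m'.
Hypothesis N_large : 8 * m * m <= N.

Let N1 : 3 * N ^ m <= 4 * (N.-1) ^_ m.
Proof.
rewrite -subn1 ffact_large //; apply: leq_trans N_large.
by rewrite -mulnA -[8]/(4 * 2) -!mulnA leq_mul2l /= mulnCA leq_mul2l /=; lia.
Qed.

Lemma fact_arrangements (h : V -> pos) :
  (N * m)`! <= 12 ^ N * #|arrangements A good finset.set0 h|.
Proof.
have := repair cardA few_bad K_small N1; rewrite (bad_at_most0 _ _ h) => H.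
rewrite -(leq_pmul2r (fact_gt0 N)) (leq_trans H) // expnMn.
have -> : 12 ^ N = 3 ^ N * 4 ^ N by rewrite -expnMn.
rewrite -!mulnA leq_mul2l /=; apply/orP; right.
by rewrite (leq_trans (leq_mul (expnn_fact N) (leqnn _))) // mulnAC -mulnA.
Qed.

Lemma arrangements_gt0 (h : V -> pos)
  : 0 < #|arrangements A good finset.set0 h|.
Proof.
have := leq_trans (fact_gt0 _) (fact_arrangements h).
by rewrite muln_gt0 => /andP[].
Qed.

(* The factor 12 ^ N lost by repairing an arbitrary placement is at most      *)
(* 12 ^ (8 * m * #|X|) once X is large.                                       *)
Definition spread_const := 4 * 12 ^ (8 * m).

(** If 8m|X| < N, switchings apply. Otherwise drop goodness and bound the numerator by (N * m -
    |X|)!; [fact_arrangements] then loses 12^N, affordable since N <= 8m|X|. *)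
Lemma arrangements_spread X (h : V -> pos) :
  #|arrangements A good X h| * N ^ #|X|
    <= spread_const ^ #|X| * #|arrangements A good finset.set0 h|.
Proof.
case: (ltnP (8 * m * #|X|) N) => XN.
  have NX : 3 * N ^ m <= 4 * (N - #|X|) ^_ m.
    apply: ffact_large; move: XN N_large; move: #|X| => x.
    by rewrite mulnDr -[8]/(4 + 4) !mulnDl; lia.
  apply: leq_trans (arrangements_few cardA few_bad K_small h NX) _.
  rewrite leq_mul2r; apply/orP; right; case: (posnP #|X|) => [-> //|X0].
  by rewrite leq_exp2r // /spread_const -[2]/(2 * 1) leq_mul // expn_gt0.
case: (set_0Vmem (arrangements A good X h)) => [->|[f0 f0P]];
  first by rewrite cards0.
have N0 : 0 < N by apply: leq_trans N_large.
have [hinj XA] : {in X &, injective h} /\ X \subset A.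
  move: f0P; rewrite inE => /and3P[/andP[_ /forallP fA] _ /forall_inP fX];
    split.
    by move=> x y /fX/eqP {2}<- /fX/eqP {2}<- ->.
  by apply/fintype.subsetP => x /fX/eqP <-.
have Xn : #|X| <= N * m by rewrite -cardA subset_leq_card.
have H1 : #|arrangements A good X h| <= (N * m - #|X|)`!.
  pose g (x : pos) : V := f0 x.
  apply: leq_trans (subset_leq_card _) _; last first.
    have := card_inj_prescribed A (h @: X) g.
    by rewrite (card_in_imset hinj) cardA card_prod !card_ord ffactnn; apply.
  apply/fintype.subsetP => f; rewrite !inE =>
    /and3P[/andP[-> ->] _ /forall_inP fX] /=.
  apply/forall_inP => _ /imsetP[x xX ->]; rewrite (eqP (fX x xX)) /g.
  by move: f0P; rewrite inE => /and3P[_ _ /forall_inP/(_ x xX)/eqP ->].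
have H2 := expn_ffact Xn; have H3 := fact_arrangements h.
rewrite /spread_const expnMn -expnM.
apply: (@leq_trans ((N * m - #|X|)`! * (N * m) ^ #|X|)).
  by rewrite leq_mul // expnMn leq_pmulr // expn_gt0.
apply: leq_trans (leq_mul (leqnn _) H2) _.
rewrite mulnCA [_`! * _]mulnC ffact_fact // -mulnA leq_mul2l.
apply/orP; right; apply: leq_trans H3 _; rewrite leq_mul2r leq_pexp2l ?orbT //.
Qed.

End ArrangementBound.

(** * Spread measures on perfect matchings *)

Definition matching_on (V : finType) (H : {set {set V}}) (S : {set V})
    (M : {set {set V}}) : bool :=
  [&& M \subset H, finset.trivIset M & finset.cover M == S].

Definition matchable (V : finType) (H : {set {set V}}) (S : {set V}) : bool :=
  [exists M : {set {set V}}, matching_on H S M].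

Lemma card_cover_uniform (V : finType) (k : nat) (H T : {set {set V}}) :
  uniform k H -> T \subset H -> finset.trivIset T -> #|finset.cover T| = (k * #|T|)%N.
Proof.
move=> /forall_inP Hk TH /eqP <-; rewrite mulnC -sum_nat_const.
by apply: eq_bigr => e eT; apply/eqP/Hk/(fintype.subsetP TH).
Qed.

Section BlockMatchings.
Local Open Scope nat_scope.
Variables (V : finType) (N m' k : nat) (A : {set V}) (H : {set {set V}}).
Local Notation m := m'.+1.
Local Notation pos := ('I_N * 'I_m)%type.
Hypothesis cardA : #|A| = N * m.
Hypothesis Hk : uniform k H.
Implicit Types (f : {ffun pos -> V}) (T : {set {set V}}).

Definition the_matching (S : {set V}) : {set {set V}} :=
  odflt finset.set0 [pick M : {set {set V}} | matching_on H S M].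

Lemma the_matchingP S : matchable H S -> matching_on H S (the_matching S).
Proof.
rewrite /the_matching => /existsP[M HM]; case: pickP => //= /(_ M).
by rewrite HM.
Qed.

Definition block_matching f : {set {set V}} :=
  \bigcup_(b : 'I_N) the_matching (block f b).

Variable h0 : V -> pos.
Local Notation Omega := (arrangements A (matchable H) finset.set0 h0).

Lemma block_matching_block f e : f \in Omega -> e \in block_matching f ->
  exists2 b, e \in the_matching (block f b) & e \subset block f b.
Proof.
rewrite inE => /and3P[_ /forallP fgood _] /finset.bigcupP[b _ eb].
exists b => //; have /and3P[_ _ /eqP <-] := the_matchingP (fgood b).
exact: finset.bigcup_sup.
Qed.

Lemma block_matching_on f : f \in Omega -> matching_on H A (block_matching f).
Proof.
move=> fO; have := fO; rewrite inE =>
  /and3P[/andP[/injectiveP injf /forallP fA] /forallP fgood _].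
have M b := the_matchingP (fgood b).
apply/and3P; split.
- by apply/finset.bigcupsP => b _; case/and3P: (M b).
- apply/finset.trivIsetP => e e' eM e'M ee'.
  have [b eb eB] := block_matching_block fO eM.
  have [b' eb' eB'] := block_matching_block fO e'M.
  case: (eqVneq b b') => [E|bb'].
    rewrite -E in eb'; case/and3P: (M b) => _ /finset.trivIsetP tI _; exact: tI.
  apply: disjointWl eB _; apply: disjointWr eB' _.
  rewrite -finset.setI_eq0; apply/eqP/setP => v; rewrite !inE.
  apply/negP => /andP[/imsetP[i _ ->] /imsetP[i' _ /injf E]].
  by have /= E1 := congr1 fst E; rewrite E1 eqxx in bb'.
have imA : [set f x | x : pos] = A.
  apply/eqP; rewrite eqEcard card_imset //
    cardA card_prod !card_ord leqnn andbT.
  by apply/fintype.subsetP => _ /imsetP[x _ ->].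
rewrite -imA; apply/eqP/setP => v; apply/finset.bigcupP/imsetP.
  move=> [e eM ve]; have [b _ /fintype.subsetP/(_ v ve)/imsetP[i _ ->]] :=
    block_matching_block fO eM.
  by exists (b, i).
move=> [[b i] _ ->]; have : f (b,
  i) \in finset.cover (the_matching (block f b)).
  by case/and3P: (M b) => _ _ /eqP ->; exact: imset_f.
case/finset.bigcupP => e eb fe; exists e => //.
by apply/finset.bigcupP; exists b.
Qed.

(* Union bound over the blocks receiving the edges of T and the positions of  *)
(* the vertices of T inside their blocks.                                     *)
Lemma card_block_matching_sup (C : nat) T :
  0 < N -> T \subset H ->
  (forall X (h : V -> pos), #|arrangements A (matchable H) X h| * N ^ #|X| <=
    C ^ #|X| * #|Omega|) ->
  #|[set f in Omega | T \subset block_matching f]| * N ^ (k * #|T|)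
    <= (N * m ^ k * C ^ k) ^ #|T| * #|Omega|.
Proof.
move=> N0 TH spreadC.
set F := [set f in Omega | _]; case: (set_0Vmem F) => [->|[f0]].
  by rewrite cards0.
rewrite inE => /andP[f0O Tf0].
have tT : finset.trivIset T.
  by apply: finset.trivIsetS Tf0 _; case/and3P: (block_matching_on f0O).
have cX := card_cover_uniform Hk TH tT; set X := finset.cover T in cX *.
pose b0 : 'I_N := Ordinal N0.
(* The functions are constant outside [T] and [X], so that the union bound has only N^|T| * m^(k|T|)
   terms. *)
pose Bs := pffun_on b0 (mem T) (predT : pred 'I_N).
pose Ps := pffun_on (ord0 : 'I_m) (mem X) (predT : pred 'I_m).
pose h (bp : {ffun {set V} -> 'I_N} * {ffun V -> 'I_m}) v : pos :=
  (bp.1 (finset.pblock T v), bp.2 v).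
pose W := [set bp : {ffun {set V} -> 'I_N} * {ffun V -> 'I_m} | (bp.1 \in Bs)
  && (bp.2 \in Ps)].
have cW : #|W| = N ^ #|T| * m ^ (k * #|T|).
  rewrite (_ : W = finset.setX [set x in Bs] [set x in Ps]); last first.
    by apply/setP => [[x y]]; rewrite !inE.
  by rewrite cardsX !cardsE !card_pffun_on !card_ord cX.
have FW : F \subset \bigcup_(bp in W) arrangements A (matchable H) X (h bp).
  apply/fintype.subsetP => f; rewrite inE => /andP[fO Tf].
  have fb e : e \in T -> exists b, e \subset block f b.
    move=> eT; have [b _ eb] :=
      block_matching_block fO (fintype.subsetP Tf e eT).
    by exists b.
  pose be : {ffun {set V} -> 'I_N} := [ffun e : {set V} =>
    if e \in T then odflt b0 [pick b | e \subset block f b] else b0].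
  have beP e : e \in T -> e \subset block f (be e).
    move=> eT; have [b eb] := fb e eT; rewrite ffunE eT.
    by case: pickP => //= /(_ b); rewrite eb.
  pose ph : {ffun V -> 'I_m} := [ffun v =>
    if v \in X then odflt ord0 [pick i | f (be (finset.pblock T v),
      i) == v] else ord0].
  have phP v : v \in X -> f (be (finset.pblock T v), ph v) = v.
    move=> vX; rewrite [ph v]ffunE vX.
    have /fintype.subsetP/(_ v) := beP _ (finset.pblock_mem vX).
    rewrite finset.mem_pblock => /(_ vX)/imsetP[i _ E].
    by case: pickP => [j /eqP -> //|/(_ i)]; rewrite -E eqxx.
  apply/finset.bigcupP; exists (be, ph).
    rewrite inE; apply/andP; split; apply/pffun_onP; split=> //.
      by apply/supportP => e eT; rewrite ffunE (negPf eT).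
    by apply/supportP => v vX; rewrite ffunE (negPf vX).
  move: fO; rewrite !inE => /and3P[-> -> _] /=; apply/forall_inP => v vX.
  by rewrite /h /= phP.
have /(leq_trans (subset_leq_card FW)) := card_bigcup_le (fun bp => bp \in W)
  (fun bp => arrangements A (matchable H) X (h bp)).
move=> /leq_mul/(_ (leqnn (N ^ (k * #|T|)))) /leq_trans; apply.
rewrite big_distrl /= -cX.
apply: (@leq_trans (\sum_(bp in W) C ^ #|X| * #|Omega|)).
  by apply: leq_sum => bp _; exact: spreadC.
rewrite sum_nat_const cW cX !expnMn -!expnM !mulnA.
by [].
Qed.

End BlockMatchings.

Section SpreadMatchings.
Variables (R : realType) (V : finType).

Definition spread_matchings (q : R) (H : {set {set V}}) (A : {set V}) : Prop :=
  exists mu : {set {set V}} -> R,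
    [/\ forall S, 0 <= mu S, forall S, mu S != 0 -> matching_on H A S,
        mass mu = 1 & spread q mu].

Definition edge_spread_const (m k : nat) : nat :=
  ((m.+1 * spread_const m) ^ k)%N.

(** The measure is the law of [block_matching] for a uniformly random good arrangement. *)
Lemma block_spread_matchings (N m' k : nat) (A : {set V}) (H : {set {set V}})
  (K : nat) :
  (0 < k)%N -> uniform k H -> #|A| = (N * m'.+1)%N ->
  (forall (i0 : 'I_m'.+1) v, v \in A -> (#|bad_rows A (matchable H) i0 v| <=
    K)%N) ->
  (8 * m'.+1 * K <= (N * m'.+1) ^ m')%N -> (8 * m'.+1 * m'.+1 <= N)%N ->
  spread_matchings ((edge_spread_const m' k)%:R / N%:R ^+ k.-1) H A.
Proof.
move=> k0 Hk cardA few K_small N_large.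
have N0 : (0 < N)%N by apply: leq_trans N_large.
pose h0 (v : V) : 'I_N * 'I_m'.+1 := (Ordinal N0, ord0).
set Om := arrangements A (matchable H) finset.set0 h0.
have Om0 : (0 < #|Om|)%N by exact: arrangements_gt0 cardA few K_small N_large h0.
have Om0R : 0 < #|Om|%:R :> R by rewrite ltr0n.
pose mu (S : {set {set V}}) : R :=
  #|[set f in Om | block_matching H f == S]|%:R / #|Om|%:R.
have sup (T : {set {set V}}) : \sum_(S : {set {set V}} | T \subset S) mu S =
    #|[set f in Om | T \subset block_matching H f]|%:R / #|Om|%:R.
  rewrite -mulr_suml -natr_sum; congr (_%:R / _).
  rewrite -[RHS]sum1_card (partition_big (block_matching H) (fun S =>
    T \subset S)) /=;
    last by move=> f; rewrite inE => /andP[].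
  apply: eq_bigr => S TS; rewrite sum1dep_card; apply: eq_card => f;
    rewrite !inE.
  by case: eqP => [->|]; rewrite ?TS ?andbF ?andbT.
exists mu; split=> [S|S|| T].
- by rewrite divr_ge0.
- rewrite mulf_eq0 invr_eq0 !pnatr_eq0 negb_or => /andP[].
  rewrite cards_eq0 => /set0Pn[f]; rewrite inE => /andP[fO /eqP <-] _.
  exact: block_matching_on fO.
- have := sup finset.set0; under eq_bigl => S do rewrite finset.sub0set.
  rewrite /mass => ->; rewrite (_ : [set f in Om | _] = Om) ?divff ?gt_eqF //.
  by apply/setP => f; rewrite inE finset.sub0set andbT.
rewrite sup; case: (boolP (T \subset H)) => TH; last first.
  rewrite (_ : [set f in Om | _] = finset.set0)
    ?cards0 ?mul0r ?exprn_ge0 ?divr_ge0 //.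
  apply/setP => f; rewrite finset.in_set0 inE; apply/negbTE;
    apply: contra TH => /andP[fO TM].
  by apply: fintype.subset_trans TM _; case/and3P: (block_matching_on cardA fO).
have spr X (h : V -> 'I_N * 'I_m'.+1) :=
  arrangements_spread cardA few K_small N_large X h.
have spr' X (h : V -> 'I_N * 'I_m'.+1) : (#|arrangements A (matchable H)
  X h| * N ^ #|X| <=
    spread_const m' ^ #|X| * #|Om|)%N.
  by rewrite /Om (arrangements0 A (matchable H) h0 h).
have le := card_block_matching_sup cardA Hk N0 TH spr'.
rewrite -/Om -(ler_nat R) !natrM !natrX !natrM !natrX in le.
have NR : 0 < N%:R :> R by rewrite ltr0n.
rewrite ler_pdivrMr // -(ler_pM2r (exprn_gt0 (k * #|T|) NR)).
apply: le_trans le _; rewrite /edge_spread_const natrX natrM.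
rewrite [leRHS]mulrAC ler_wpM2r // exprM -[leRHS]exprMn.
suff -> : N%:R * m'.+1%:R ^+ k * (spread_const m')%:R ^+ k =
   (m'.+1%:R * (spread_const m')%:R) ^+ k / N%:R ^+ k.-1 * N%:R ^+ k :> R by [].
rewrite exprMn; case: k k0 {Hk sup TH spr spr'} => // k _.
by rewrite [k.+1.-1]/= (exprSr N%:R) mulrA divfK ?expf_neq0 ?gt_eqF //
  -mulrA [LHS]mulrC.
Qed.

End SpreadMatchings.

(** * Adding one random edge to a spread matching *)

Section GlueSpread.
Variables (R : realType) (V : finType) (q : R) (H : {set {set V}}).
Variables (A B : {set V}) (v : V).
Hypotheses (q0 : 0 <= q) (vB : v \in B) (BA : B \subset A).
Hypothesis spreadB : spread_matchings q H B.
Hypothesis spread_rest : forall e, e \in H -> v \in e -> e \subset B ->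
  spread_matchings q H (A :\: e).

Lemma matching_edge_at (M : {set {set V}}) : matching_on H B M ->
  [set e in M | v \in e] = [set finset.pblock M v].
Proof.
move=> /and3P[_ tM /eqP cM]; apply/setP => e; rewrite !inE.
have vM : v \in finset.cover M by rewrite cM.
apply/andP/eqP => [[eM ve]|->]; first by rewrite (finset.def_pblock tM eM ve).
by rewrite finset.pblock_mem // finset.mem_pblock.
Qed.

Lemma matching_setU1 (e : {set V}) (M : {set {set V}})
  : e \in H -> e \subset A ->
  matching_on H (A :\: e) M -> matching_on H A (e |: M).
Proof.
move=> eH eA /and3P[MH /finset.trivIsetP tM /eqP cM]; apply/and3P; split.
- by rewrite finset.subUset finset.sub1set eH.
- have eM e' : e' \in M -> [disjoint e & e'].
    move=> e'M; have : e' \subset A :\: e by rewrite -cM;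
      exact: finset.bigcup_sup.
    by rewrite finset.subsetD disjoint_sym => /andP[].
  apply/finset.trivIsetP => e1 e2; rewrite !inE =>
    /predU1P[->|e1M] /predU1P[->|e2M].
  + by rewrite eqxx.
  + by move=> _; exact: eM.
  + by move=> _; rewrite disjoint_sym; exact: eM.
  + exact: tM.
rewrite /finset.cover finset.bigcup_setU finset.big_set1 -/(finset.cover M) cM.
by apply/eqP/setP => u; rewrite !inE; case: (boolP (u \in e)) =>
  //= /(fintype.subsetP eA).
Qed.

(* The edge at v is drawn from a spread matching of B, the rest from a spread *)
(* matching of A :\: e.  A matching has a single edge at v, so no constant is *)
(* lost in the spread.                                                        *)
Lemma glue_spread_matchings : spread_matchings q H A.
Proof.
have [muB [muB0 muBM muB1 muBq]] := spreadB.
pose nu (e : {set V}) : R := \sum_(S : {set {set V}} | e \in S) muB S.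
have nu0 e : 0 <= nu e by apply: sumr_ge0.
have nuB e : nu e != 0 -> e \in H /\ e \subset B.
  move=> nz; have [S /andP[eS /muBM/and3P[SH _ /eqP <-]]] :
      exists S : {set {set V}}, (e \in S) && (muB S != 0).
    apply/existsP; apply: contra_neqT nz; rewrite negb_exists => /forallP h.
    by apply: big1 => S eS; apply/eqP; have := h S; rewrite eS negbK.
  by split; [exact: (fintype.subsetP SH) | exact: finset.bigcup_sup].
have nuq e : nu e <= q.
  rewrite -[q]expr1 -(cards1 e); apply: le_trans (muBq [set e]).
  by rewrite le_eqVlt; apply/orP; left; apply/eqP/eq_bigl => S;
    rewrite finset.sub1set.
have nu1 : \sum_(e : {set V} | v \in e) nu e = 1.
  rewrite -muB1 /mass /nu (exchange_big_dep predT) //=; apply: eq_bigr => S _.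
  case: (eqVneq (muB S) 0) => [->|/muBM SM]; first by rewrite big1.
  rewrite sumr_const -[RHS]mulr1n; congr (_ *+ _).
  rewrite -(cards1 (finset.pblock S v)) -(matching_edge_at SM);
    apply: eq_card => e.
  by rewrite !inE unfold_in andbC.
have /boolp.choice[mue mueP] : forall e : {set V},
  exists mu : {set {set V}} -> R,
    nu e != 0 -> v \in e ->
    [/\ forall S, 0 <= mu S, forall S, mu S != 0 -> matching_on H (A :\: e) S,
        mass mu = 1 & spread q mu].
  move=> e; case: (boolP ((nu e != 0) && (v \in e))) => [/andP[nz ve]|no].
    by have [eH eB] := nuB e nz; have [mu hmu] := spread_rest eH ve eB;
      exists mu.
  by exists (fun=> 0) => nz ve; rewrite nz ve in no.
pose mu (S : {set {set V}}) : R := \sum_(e : {set V} | (nu e != 0) && (v \in e))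
   \sum_(S' : {set {set V}} | S == e |: S') nu e * mue e S'.
have sum_mu (P : pred {set {set V}}) : \sum_(S | P S) mu S =
    \sum_(e : {set V} | (nu e != 0) &&
      (v \in e)) nu e * \sum_(S' | P (e |: S')) mue e S'.
  rewrite /mu (exchange_big_dep (fun e : {set V} => (nu e != 0) &&
    (v \in e))) //=.
  apply: eq_bigr => e he; rewrite mulr_sumr (exchange_big_dep (fun S' =>
    P (e |: S'))) /=;
    last by move=> S S' /andP[PS _] /eqP <-.
  apply: eq_bigr => S' PS'; rewrite (big_pred1 (e |: S')) // => S /=.
  by rewrite he andbT; case: eqP => [->|]; rewrite ?PS' ?andbF.
have muM S : mu S != 0 -> matching_on H A S.
  move=> nz; have [[e S'] /and4P[/= nz' ve /eqP -> mz]] :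
      exists x : {set V} * {set {set V}}, [&& nu x.1 != 0, v \in x.1,
        S == x.1 |: x.2 & mue x.1 x.2 != 0].
    apply/existsP; apply: contra_neqT nz; rewrite negb_exists => /forallP h.
    apply: big1 => e /andP[nz ve]; apply: big1 => S' /eqP SS'.
    by apply/eqP; have := h (e, S'); rewrite /= nz ve SS' eqxx /= negbK =>
      /eqP ->; rewrite mulr0.
  have [eH eB] := nuB e nz'; apply: matching_setU1 => //.
    exact: fintype.subset_trans eB BA.
  by have [_ h _ _] := mueP e nz' ve; exact: h.
have nu1' : \sum_(e : {set V} | (nu e != 0) && (v \in e)) nu e = 1.
  rewrite -nu1 [RHS](bigID (fun e => nu e != 0)) /= [X in _ = _ + X]big1 ?addr0.
    by apply: eq_bigl => e; rewrite andbC.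
  by move=> e /andP[_ /negPn/eqP].
exists mu; split=> // [S||T].
- apply: sumr_ge0 => e /andP[nz ve]; apply: sumr_ge0 => S' _.
  by have [h _ _ _] := mueP e nz ve; rewrite mulr_ge0.
- rewrite /mass (sum_mu predT) -[RHS]nu1'; apply: eq_bigr => e /andP[nz ve].
  by have [_ _ h _] := mueP e nz ve; rewrite -/(mass _) h mulr1.
case: (boolP (finset.trivIset T)) => tT; last first.
  rewrite big1 ?exprn_ge0 // => S TS; apply/eqP; apply: contraNT tT =>
    /muM/and3P[_ tS _].
  exact: finset.trivIsetS tS.
rewrite sum_mu; case: (boolP [exists e0 in T, v \in e0]) =>
  [/existsP[e0 /andP[e0T ve0]]|no].
  (* If another edge e is drawn at [v], the rest matches [A :\: e] and cannot contain [e0], which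
     passes through [v]. *)
  have zero e : (nu e != 0) && (v \in e) -> e != e0 ->
      \sum_(S' : {set {set V}} | T \subset e |: S') mue e S' = 0.
    move=> /andP[nz ve] ne; apply: big1 => S' TS'; apply/eqP; apply/negP =>
      /negP mz.
    have [_ h _ _] := mueP e nz ve; have /and3P[_ _ /eqP cS'] := h _ mz.
    have : e0 \in e |: S' := fintype.subsetP TS' e0 e0T.
    rewrite !inE eq_sym (negPf ne) /= => e0S'.
    have : v \in finset.cover S' by apply/finset.bigcupP; exists e0.
    by rewrite cS' !inE ve.
  case: (boolP (nu e0 != 0)) => nz0; last first.
    rewrite big1 ?exprn_ge0 // => e /[dup] h /zero ->; rewrite ?mulr0 //.
    by apply: contra nz0 => /eqP <-; case/andP: h.
  rewrite (bigD1 e0) ?nz0 //= [X in _ + X]big1 ?addr0; last first.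
    by move=> e /andP[h ne]; rewrite zero ?mulr0.
  rewrite (cardsD1 e0) e0T exprS ler_pM ?nuq //.
    by apply: sumr_ge0 => S' _; have [h _ _ _] := mueP e0 nz0 ve0.
  have [h0 _ _ h] := mueP e0 nz0 ve0; apply: le_trans (h _).
  rewrite big_mkcond [leRHS]big_mkcond; apply: ler_sum => S' _.
  by rewrite finset.subDset; case: ifP.
rewrite -[leRHS]mul1r -nu1' mulr_suml; apply: ler_sum => e /andP[nz ve].
rewrite ler_wpM2l //; have [h0 _ _ h] := mueP e nz ve; apply: le_trans (h T).
rewrite big_mkcond [leRHS]big_mkcond; apply: ler_sum => S' _.
case: ifP => [/fintype.subsetP TS'|_]; last by case: ifP.
rewrite (_ : T \subset S') //; apply/fintype.subsetP => e' e'T.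
have := TS' e' e'T; rewrite !inE => /predU1P[E|//].
by case/negP: no; apply/existsP; exists e; rewrite -E e'T E.
Qed.

End GlueSpread.

Lemma subset_of_card (T : finType) (A : {set T}) (j : nat) : (j <= #|A|)%N ->
  exists2 B : {set T}, B \subset A & #|B| = j.
Proof.
rewrite -bin_gt0 -cards_draws => /card_gt0P[B]; rewrite inE =>
  /andP[BA /eqP cB].
by exists B.
Qed.

Lemma bad_rowsS (V : finType) (m' : nat) (A B : {set V}) (good : pred {set V})
    (i0 : 'I_m'.+1) v :
  B \subset A -> bad_rows B good i0 v \subset bad_rows A good i0 v.
Proof.
move=> /fintype.subsetP BA; apply/fintype.subsetP => x; rewrite !inE.
move=> /and4P[-> /forallP xB -> ->]; rewrite /= andbT; apply/forallP => i.
exact: BA.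
Qed.

(** The size of [A] exceeds a multiple of m by k * [rho]. Gluing an edge drawn inside a subset of
    size N * m lowers [rho] by one and keeps the spread constant. *)
Lemma rest_spread_matchings (R : realType) (V : finType) (N m' k : nat)
    (H : {set {set V}}) (K rho : nat) (A : {set V}) :
  (0 < k)%N -> uniform k H -> #|A| = (N * m'.+1 + k * rho)%N ->
  (forall (i0 : 'I_m'.+1) v, v \in A -> (#|bad_rows A (matchable H) i0 v| <=
    K)%N) ->
  (8 * m'.+1 * K <= (N * m'.+1) ^ m')%N -> (8 * m'.+1 * m'.+1 <= N)%N ->
  spread_matchings ((edge_spread_const m' k)%:R / N%:R ^+ k.-1 : R) H A.
Proof.
move=> k0 Hk cA few K_small N_large; elim: rho A cA few => [|rho IH] A cA few.
  by apply: (block_spread_matchings R k0 Hk) few K_small N_large;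
    rewrite cA muln0 addn0.
have [|B BA cB] := @subset_of_card V A (N * m'.+1);
  first by rewrite cA leq_addr.
have B0 : (0 < #|B|)%N.
  by rewrite cB muln_gt0 andbT; apply: leq_trans N_large.
have [v vB] := card_gt0P B0.
have fewS (A' : {set V}) : A' \subset A -> forall (i0 : 'I_m'.+1) u, u \in A' ->
    (#|bad_rows A' (matchable H) i0 u| <= K)%N.
  move=> A'A i0 u uA'; apply: leq_trans (few i0 u (fintype.subsetP A'A u uA')).
  exact/subset_leq_card/bad_rowsS.
apply: (glue_spread_matchings _ vB BA) => [||e eH ve eB].
- by rewrite divr_ge0 ?exprn_ge0.
- exact: (block_spread_matchings R k0 Hk cB (fewS B BA)).
have eA := fintype.subset_trans eB BA.
apply: IH; last by apply: fewS; exact: finset.subsetDl.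
by rewrite cardsDS // cA (eqP (forall_inP Hk e eH)) (mulnS k) addnCA addKn.
Qed.

(** * Sampling blocks *)

Section Chernoff.
Variable R : realType.

Lemma expRN_le (x : R) : 0 <= x -> expR (- x) <= 1 - x + x ^+ 2.
Proof.
move=> x0; have x1 : 0 < 1 + x by rewrite ltr_wpDr.
rewrite expRN; apply: (@le_trans _ _ (1 + x)^-1).
  by rewrite lef_pV2 ?posrE ?expR_gt0 // expR_ge1Dx.
rewrite -[leLHS]mul1r ler_pdivrMr //.
have -> : (1 - x + x ^+ 2) * (1 + x) = 1 + x ^+ 3 by ring.
by rewrite lerDl exprn_ge0.
Qed.

(** Markov's inequality for the exponential moment with parameter -d/2, using e^-x <= 1 - x + x^2;
    the exponent becomes at most -d^2/2 + d^2/4. *)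
Lemma chernoff (U : finType) (L : {set U}) (w : nat) (p d : R) :
  p * #|U|%:R <= #|L|%:R -> 0 <= p <= 1 -> 0 <= d ->
  #|[set u : {ffun 'I_w -> U} | #|[set g | u g \in L]|%:R <= (p - d) * w%:R]|%:R
    <= (#|U| ^ w)%:R * expR (- (d ^+ 2 / 4) * w%:R).
Proof.
move=> pL /andP[p0 p1] d0; set B := [set u : {ffun 'I_w -> U} | _].
pose la := d / 2; have la0 : 0 <= la by rewrite divr_ge0.
pose F (y : U) : R := if y \in L then expR (- la) else 1.
have F0 y : 0 <= F y by rewrite /F; case: ifP => // _; exact: expR_ge0.
have prodF (u : {ffun 'I_w -> U}) :
    \prod_g F (u g) = expR (- la * #|[set g | u g \in L]|%:R).
  rewrite /F -big_mkcond /= (eq_bigl (fun g => g \in [set g | u g \in L])) /=;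
    last by move=> g; rewrite inE.
  by rewrite prodr_const expRM_natr.
have sumF : \sum_y F y <= #|U|%:R * expR (- p * (la - la ^+ 2)).
  have -> : \sum_y F y = #|U|%:R - (1 - expR (- la)) * #|L|%:R.
    rewrite (eq_bigr (fun y => 1 - (1 - expR (- la)) * (y \in L)%:R)) => [|y _].
      rewrite sumrB sumr_const -mulr_sumr -natr_sum -[#|L|]sum1_card [in RHS]big_mkcond.
      by congr (_ - _ * _%:R); apply: eq_bigr => y _; case: (y \in L).
    by rewrite /F; case: ifP => _ /=; rewrite ?mulr1 ?mulr0; ring.
  have h := expRN_le la0; have le1 : la - la ^+ 2 <= 1 - expR (- la) by lra.
  have e1 : 0 <= 1 - expR (- la) by rewrite subr_ge0 -expR0 ler_expR oppr_le0.
  apply: (@le_trans _ _ (#|U|%:R * (1 - p * (la - la ^+ 2)))).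
    have h1 := ler_wpM2l e1 pL.
    have pU : 0 <= p * #|U|%:R by rewrite mulr_ge0.
    have h2 := ler_wpM2r pU le1.
    rewrite [leRHS](_ : _ = #|U|%:R - (la - la ^+ 2) * (p * #|U|%:R));
      last by ring.
    by rewrite lerD2l lerN2 (le_trans h2).
  by rewrite ler_wpM2l // mulNr expR_ge1Dx.
have main : #|B|%:R * expR (- la * ((p - d) * w%:R)) <= (\sum_y F y) ^+ w.
  rewrite -[X in _ ^+ X]card_ord -prodr_const bigA_distr_bigA /=.
  rewrite mulr_natl -sumr_const big_mkcond /=.
  apply: ler_sum => u _; rewrite inE; case: ifP => [hu|_];
    last exact: prodr_ge0.
  by rewrite prodF ler_expR !mulNr lerN2 ler_wpM2l.
rewrite -ler_pdivlMr ?expR_gt0 // -expRN in main; apply: le_trans main _.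
apply: (@le_trans _ _ ((#|U|%:R * expR (- p * (la - la ^+ 2)))
  ^+ w * expR (- (- la * ((p - d) * w%:R))))).
  have S0 : 0 <= \sum_y F y by apply: sumr_ge0.
  have T0 : 0 <= #|U|%:R * expR (- p * (la - la ^+ 2)) by rewrite mulr_ge0 //
    expR_ge0.
  by rewrite ler_wpM2r ?expR_ge0 // lerXn2r // nnegrE.
rewrite exprMn -expRM_natr -mulrA -expRD natrX ler_wpM2l ?exprn_ge0 // ler_expR.
rewrite [leLHS](_ : _ = (la * (p - d) - p * (la - la ^+ 2)) * w%:R);
  last by ring.
rewrite ler_wpM2r //.
have -> : - (d ^+ 2 / 4) = la ^+ 2 - la * d by rewrite /la; field.
have : p * la ^+ 2 <= la ^+ 2 by rewrite ler_piMl ?exprn_ge0.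
by lra.
Qed.

End Chernoff.

Section Sampling.
Variables (V : finType) (H : {set {set V}}) (k l m' w : nat).
Local Notation m := m'.+1.
Local Notation D := (k - l)%N.
Local Notation rows := ({ffun 'I_m -> V}).
Local Notation groups := ({ffun 'I_w -> {ffun 'I_D -> V}}).
Implicit Types (L : {set V}) (J : {set 'I_m}) (x : rows) (u : groups).
Implicit Types (s : {ffun 'I_w * 'I_D -> 'I_m}).

(** Tuples with repetition allowed are independent samples; if |L| = l and [H] is k-uniform,
    membership already forces the entries to be distinct and outside [L]. *)
Definition link L : {set {ffun 'I_D -> V}} :=
  [set y : {ffun 'I_D -> V} | L :|: [set y j | j : 'I_D] \in H].

Lemma card_link L : uniform k H -> #|L| = l -> (degree H L * D`! <=
  #|link L|)%N.
Proof.
move=> /forall_inP Hk cL.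
pose E := [set e in H | L \subset e].
pose Y (e : {set V}) := [set y in ffun_on (mem (e :\: L))
  | injectiveb (y : {ffun 'I_D -> V})].
have cY e : e \in E -> #|Y e| = D`!.
  rewrite inE => /andP[eH Le]; rewrite card_inj_ffuns_on card_ord.
  by rewrite (_ : #|mem (e :\: L)| = D) ?ffactnn // cardsDS //
    (eqP (Hk e eH)) cL.
have YL e y : e \in E -> y \in Y e -> L :|: [set y j | j : 'I_D] = e.
  move=> /[dup] eE; rewrite !inE =>
    /andP[eH Le] /andP[/ffun_onP yD /injectiveP injy].
  have -> : [set y j | j : 'I_D] = e :\: L.
    apply/eqP; rewrite eqEcard card_imset // card_ord cardsDS //
      (eqP (Hk e eH)) cL leqnn andbT.
    by apply/fintype.subsetP => _ /imsetP[j _ ->]; exact: yD.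
  apply/setP => a; rewrite !inE; case: (boolP (a \in L)) => //= aL.
  by rewrite (fintype.subsetP Le).
pose S := [set ey : {set V} * {ffun 'I_D -> V} | (ey.1 \in E) &&
  (ey.2 \in Y ey.1)].
have -> : (degree H L * D`! = #|S|)%N.
  rewrite -[#|S|]sum1_card (eq_bigl (fun ey : {set V} * {ffun 'I_D -> V} =>
    (ey.1 \in E) && (ey.2 \in Y ey.1))); last by move=> ey; rewrite inE.
  rewrite -(pair_big_dep (mem E) (fun e y => y \in Y e) (fun _ _ => 1%N)) /=.
  rewrite /degree -/E -sum_nat_const; apply: eq_bigr => e eE.
  by rewrite sum1_card cY.
rewrite -(card_in_imset (f := snd)) => [|[e y] [e' y']]; last first.
  rewrite finset.in_set => /andP[/= eE yY].
  rewrite finset.in_set => /andP[/= e'E y'Y] yy'.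
  by rewrite -(YL e y eE yY) -(YL e' y' e'E y'Y) yy'.
apply: subset_leq_card; apply/fintype.subsetP => _ /imsetP[[e y] + ->].
rewrite finset.in_set => /andP[/= eE yY]; rewrite finset.in_set (YL e y eE yY).
by move: eE; rewrite inE => /andP[].
Qed.

Definition glue s x u : rows :=
  [ffun i => if [pick g | s g == i] is Some g then u g.1 g.2 else x i].

Definition read s x : groups := [ffun g => [ffun j => x (s (g, j))]].

Lemma glue_in s x u g j : injective s -> glue s x u (s (g, j)) = u g j.
Proof.
by move=> inj; rewrite ffunE; case: pickP => [a /eqP/inj -> //|/(_ (g, j))];
  rewrite eqxx.
Qed.

Lemma glue_out s x u i : (forall g, s g != i) -> glue s x u i = x i.
Proof. by move=> out; rewrite ffunE; case: pickP => // g;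
  rewrite (negPf (out g)). Qed.

Lemma read_glue s x u : injective s -> read s (glue s x u) = u.
Proof. by move=> inj; apply/ffunP => g; apply/ffunP => j;
  rewrite !ffunE -[RHS](glue_in x u g j inj) ffunE. Qed.

Lemma glue_glue s x u : injective s -> glue s (glue s x u) (read s x) = x.
Proof.
move=> inj; apply/ffunP => i; rewrite ffunE; case: pickP =>
  [[g j] /= /eqP <-|out].
  by rewrite !ffunE.
by rewrite glue_out // => g; rewrite out.
Qed.

(* (x, u) |-> (glue s x u, read s x) is an involution, so averaging over x is *)
(* averaging over x and fresh independent values u on the range of s.         *)
Lemma card_resample s (P : pred rows) : injective s ->
  (#|[set x : rows | P x]| * #|{: groups}| = \sum_x #|[set u | P (glue s x u)]|)%N.
Proof.
move=> inj; pose phi (z : rows * groups) := (glue s z.1 z.2, read s z.1).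
have phiK : involutive phi by case=> x u; rewrite /phi /= glue_glue //
  read_glue.
transitivity #|[set z : rows * groups | P z.1]|.
  rewrite -cardsT -cardsX; apply: eq_card => z; rewrite !inE andbT //.
transitivity #|[set z : rows * groups | P (glue s z.1 z.2)]|.
  rewrite -(card_imset _ (inv_inj phiK)); apply: eq_card => z; rewrite inE.
  apply/imsetP/idP => [[z' + ->]|Pz].
    by rewrite inE => Pz' /=; rewrite /phi /= glue_glue.
  by exists (phi z); rewrite ?phiK ?inE.
rewrite -sum1_card (eq_bigl (fun z : rows * groups => predT z.1 &&
  P (glue s z.1 z.2)));
  last by move=> z; rewrite inE.
rewrite -(pair_big_dep predT (fun x u => P (glue s x u)) (fun _ _ => 1%N)) /=.
by apply: eq_bigr => x _; rewrite sum1dep_card.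
Qed.

Lemma card_rows_at i0 v : (#|[set x : rows | x i0 == v]| <= #|V| ^ m')%N.
Proof.
pose r x := [ffun i : {i | i != i0} => x (val i)].
have injr : {in [set x : rows | x i0 == v] &, injective r}.
  move=> x y; rewrite !inE => /eqP xv /eqP yv /ffunP E; apply/ffunP => i.
  case: (eqVneq i i0) => [->|ii0]; first by rewrite xv yv.
  by have := E (exist _ i ii0); rewrite !ffunE.
rewrite -(card_in_imset injr) (leq_trans (max_card _)) // card_ffun card_sig.
by rewrite cardC1 card_ord.
Qed.

Variable R : realType.
Variables (p d : R) (i0 : 'I_m) (v : V).

Definition poor J s x : bool :=
  #|[set g | read s x g \in link (x @: J)]|%:R <= (p - d) * w%:R.

(** Resample the slots of [s]: the set [x @: J] and the entry at [i0] stay, while the w groups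
    become independent samples, to which [chernoff] applies. *)
Lemma card_poor J s : injective s -> (forall g, s g \notin i0 |: J) ->
  (forall L, #|L| = l -> p * (#|V| ^ D)%:R <= #|link L|%:R) -> #|J| = l ->
  0 <= p <= 1 -> 0 <= d ->
  #|[set x : rows | [&& injectiveb x, x i0 == v & poor J s x]]|%:R
    <= (#|V| ^ m')%:R * expR (- (d ^+ 2 / 4) * w%:R).
Proof.
move=> inj sJ linkp cJ hp d0.
case: (posnP #|V|) => [V0|V0].
  rewrite (_ : [set x | _] = finset.set0) ?cards0 ?mulr_ge0 ?expR_ge0 //.
  by apply/setP => x; have := fintype.card0_eq V0 (x i0); rewrite inE.
(* Resampling does not preserve injectivity of the whole row, so it is weakened to injectivity on
   [J]. *)
pose P x := [&& x i0 == v, [forall a in J, forall b in J, (x a == x b) ==>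
  (a == b)]
  & poor J s x].
have sub : [set x : rows | [&& injectiveb x,
  x i0 == v & poor J s x]] \subset [set x : rows | P x].
  apply/fintype.subsetP => x; rewrite !finset.in_set =>
    /and3P[/injectiveP injx xv xp].
  apply/and3P; split=> //; apply/forall_inP => a _; apply/forall_inP => b _.
  by apply/implyP => /eqP/injx ->.
apply: (@le_trans _ _ #|[set x : rows | P x]|%:R);
  first by rewrite ler_nat subset_leq_card.
have G0 : 0 < #|{: groups}|%:R :> R by rewrite ltr0n !card_ffun !expn_gt0 V0.
rewrite -(ler_pM2r G0) -natrM (card_resample P inj).
have cG : #|{: groups}| = (#|{: {ffun 'I_D -> V}}| ^ w)%N by rewrite [LHS]card_ffun card_ord.
apply: (@le_trans _ _ (\sum_(x : rows | x i0 == v)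
  #|{: groups}|%:R * expR (- (d ^+ 2 / 4) * w%:R))).
  rewrite natr_sum [leRHS]big_mkcond /=; apply: ler_sum => x _.
  have gl i u : i \in i0 |: J -> glue s x u i = x i.
    by move=> iJ; apply: glue_out => g; apply: contraNneq (sJ g) => ->.
  have glJ u : glue s x u @: J = x @: J.
    by apply: eq_in_imset => i iJ; rewrite gl // !inE iJ orbT.
  case: ifP => xv; last first.
    rewrite (_ : [set u | _] = finset.set0) ?cards0 //; apply/setP => u.
    by rewrite !inE /P gl ?set11 ?xv // !inE eqxx.
  case: (boolP [forall a in J, forall b in J, (x a == x b) ==> (a == b)]) =>
    xJ; last first.
    rewrite (_ : [set u | _] = finset.set0) ?cards0 ?mulr_ge0 ?expR_ge0 //.
    apply/setP => u; rewrite !inE /P; apply/negP => /and3P[_ + _]; apply/negP.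
    apply: contra xJ => /forall_inP h; apply/forall_inP => a aJ;
      apply/forall_inP => b bJ.
    by have := forall_inP (h a aJ) b bJ; rewrite !gl // !inE ?aJ ?bJ orbT.
  have cL : #|x @: J| = l.
    rewrite card_in_imset // => a b aJ bJ E.
    by have /implyP := forall_inP (forall_inP xJ a aJ) b bJ; rewrite E =>
      /(_ (eqxx _))/eqP.
  have cU : #|{: {ffun 'I_D -> V}}| = (#|V| ^ D)%N by rewrite card_ffun card_ord.
  have lk := linkp _ cL; rewrite -cU in lk.
  rewrite cG; apply: le_trans (chernoff w lk hp d0); rewrite ler_nat.
  apply: subset_leq_card; apply/fintype.subsetP => u; rewrite !finset.in_set.
  by move=> /and3P[_ _]; rewrite /poor read_glue // glJ.
rewrite sumr_const -[leLHS]mulr_natl [leRHS]mulrAC -[leRHS]mulrA ler_wpM2r //.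
by rewrite ler_nat; apply: leq_trans (card_rows_at i0 v); rewrite cardsE.
Qed.

End Sampling.

(** * Rows whose vertices span no perfect matching *)

Section BadRows.
Variables (V : finType) (H : {set {set V}}) (k l m' w d : nat).
Local Notation m := m'.+1.
Local Notation D := (k - l)%N.
Local Notation rows := ({ffun 'I_m -> V}).
Local Notation slots := ({ffun 'I_w * 'I_D -> 'I_m}).
Implicit Types (J e : {set 'I_m}) (x : rows).
Hypothesis Hk : uniform k H.

Definition pull_back x : {set {set 'I_m}} :=
  [set e : {set 'I_m} | x @: e \in H].

Lemma pull_back_uniform x : injective x -> uniform k (pull_back x).
Proof.
move=> injx; apply/forall_inP => e; rewrite inE => /(forall_inP Hk).
by rewrite card_imset.
Qed.

Lemma pull_back_matchable x : injective x ->
  has_perfect_matching (pull_back x) -> matchable H [set x i | i : 'I_m].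
Proof.
move=> injx /existsP[M /and3P[MH tM /eqP cM]].
apply/existsP; exists [set x @: e | e : {set 'I_m} in M]; apply/and3P; split.
- apply/fintype.subsetP => _ /imsetP[e eM ->].
  by have := fintype.subsetP MH e eM; rewrite inE.
- apply/finset.trivIsetP => _ _ /imsetP[e eM ->] /imsetP[e' e'M ->] ne.
  rewrite finset.imset_disjoint //.
  by move/finset.trivIsetP: tM; apply=> //; apply: contraNneq ne => ->.
apply/eqP/setP => u; apply/finset.bigcupP/imsetP =>
  [[_ /imsetP[e eM ->] /imsetP[i _ ->]]|].
  by exists i.
move=> [i _ ->]; have : i \in finset.cover M by rewrite cM finset.in_setT.
by case/finset.bigcupP => e eM ie; exists (x @: e); exact: imset_f.
Qed.

Lemma bad_row_poor_set x : (l <=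
  m)%N -> degree_forces_pm m k l d -> injective x ->
  ~~ matchable H [set x i | i : 'I_m] ->
  exists2 J : {set 'I_m}, #|J| = l & (degree (pull_back x) J < d)%N.
Proof.
move=> lm /forallP/(_ (pull_back x))/implyP forced injx bad.
case: (boolP [exists J : {set 'I_m}, (#|J| == l) &&
  (degree (pull_back x) J < d)%N]).
  by case/existsP => J /andP[/eqP cJ dJ]; exists J.
rewrite negb_exists => /forallP all; case/negP: bad.
apply: (pull_back_matchable injx); apply: forced; rewrite pull_back_uniform //=.
apply/leq_min_degreeP; first by rewrite card_ord.
by move=> S cS; have := all S; rewrite cS eqxx /= -leqNgt.
Qed.

Definition linked_slots x J : {set {ffun 'I_D -> 'I_m}} :=
  [set y : {ffun 'I_D -> 'I_m} | [&& injectiveb y, [forall j, y j \notin J]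
     & [ffun j => x (y j)] \in link H k l (x @: J)]].

Lemma card_linked_slots x J : injective x -> #|J| = l ->
  (#|linked_slots x J| <= degree (pull_back x) J * D`!)%N.
Proof.
move=> injx cJ; pose E := [set e in pull_back x | J \subset e].
pose Y (e : {set 'I_m}) := [set y in ffun_on (mem (e :\: J))
  | injectiveb (y : {ffun 'I_D -> 'I_m})].
have sub : linked_slots x J \subset \bigcup_(e in E) Y e.
  apply/fintype.subsetP => y; rewrite finset.in_set => /and3P[injy /forallP yJ].
  rewrite finset.in_set => lk; apply/finset.bigcupP.
  exists (J :|: [set y j | j : 'I_D]).
    rewrite finset.in_set finset.subsetUl andbT finset.in_set.
    rewrite imsetU -imset_comp; move: lk; congr (_ :|: _ \in H).
    by apply: eq_imset => j; rewrite ffunE.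
  rewrite finset.in_set injy andbT; apply/ffun_onP => j.
  by rewrite !inE yJ /=; apply/orP; right; exact: imset_f.
apply: leq_trans (subset_leq_card sub) _;
  apply: leq_trans (card_bigcup_le _ _) _.
rewrite /degree -/E -sum_nat_const leq_eqVlt; apply/orP; left; apply/eqP.
apply: eq_bigr => e; rewrite inE => /andP[eH Je].
rewrite card_inj_ffuns_on card_ord (_ : #|mem (e :\: J)| = D) ?ffactnn //.
rewrite cardsDS // cJ; congr (_ - _)%N; apply/eqP.
exact: (forall_inP (pull_back_uniform injx) e eH).
Qed.

Variables (i0 : 'I_m) (v : V).

Definition slotings J : {set slots} :=
  [set s in ffun_on (mem (~: (i0 |: J))) | injectiveb (s : slots)].

Lemma slotingsP J s : s \in slotings J ->
  injective s /\ forall g, s g \notin i0 |: J.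
Proof.
rewrite finset.in_set => /andP[/ffun_onP sJ /injectiveP injs]; split=> // g.
by have := sJ g; rewrite inE.
Qed.

Lemma card_slotings J : #|slotings J| = (#|~: (i0 |: J)| ^_ (w * D))%N.
Proof. by rewrite card_inj_ffuns_on card_prod !card_ord. Qed.

(* In a uniformly random injective sloting, each group is a uniformly random  *)
(* injective sequence. *)
Lemma sum_linked_groups x J :
  (\sum_(s in slotings J) #|[set g | read s x g \in link H k l (x @: J)]|
    <= w * (#|linked_slots x J| * (#|~: (i0 |: J)| - D) ^_ (w * D - D)))%N.
Proof.
have -> : (\sum_(s in slotings J)
  #|[set g | read s x g \in link H k l (x @: J)]| =
  \sum_(g < w) #|[set s in slotings J | read s x g \in link H k l (x @: J)]|)%N.
  under eq_bigr => s _ do rewrite -sum1dep_card.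
  rewrite (exchange_big_dep predT) //=; apply: eq_bigr => g _.
  by rewrite -sum1_card; apply: eq_bigl => s; rewrite finset.in_set.
set c := (_ * (_ ^_ _))%N; apply: (@leq_trans (\sum_(g < w) c));
  last by rewrite sum_nat_const card_ord.
apply: leq_sum => g _.
pose F (y : {ffun 'I_D -> 'I_m}) := [set s : slots | [&& injectiveb s,
  [forall a, s a \in ~: (i0 |: J)] & [forall a in [set (g, j) | j : 'I_D],
    s a == y a.2]]].
have sub : [set s in slotings J | read s x g \in link H k l (x @: J)] \subset
   \bigcup_(y in linked_slots x J) F y.
  apply/fintype.subsetP => s; rewrite finset.in_set => /andP[sJ lk].
  have [injs sJ'] := slotingsP sJ; apply/finset.bigcupP; exists [ffun j =>
    s (g, j)].
    rewrite finset.in_set; apply/and3P; split.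
    - by apply/injectiveP => a b; rewrite !ffunE => /injs[].
    - by apply/forallP => j; rewrite ffunE; have := sJ' (g, j);
      rewrite !inE negb_or => /andP[].
    - suff <- : read s x g = [ffun j => x ([ffun j => s (g, j)] j)] by [].
      by apply/ffunP => j; rewrite !ffunE.
  rewrite finset.in_set; apply/and3P; split; first exact/injectiveP.
    by apply/forallP => a; rewrite finset.in_setC sJ'.
  by apply/forall_inP => _ /imsetP[j _ ->]; rewrite ffunE.
apply: leq_trans (subset_leq_card sub) _;
  apply: leq_trans (card_bigcup_le _ _) _.
rewrite /c -sum_nat_const; apply: leq_sum => y _.
have := card_inj_prescribed (~: (i0 |: J)) [set (g, j) | j : 'I_D] (fun a =>
  y a.2).
rewrite card_imset; last by move=> a b [].
rewrite card_prod !card_ord. by apply.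
Qed.

End BadRows.

Lemma ffactD n a b : (n ^_ (a + b) = n ^_ a * (n - a) ^_ b)%N.
Proof.
elim: b => [|b IHb]; first by rewrite addn0 muln1.
by rewrite addnS !ffactnSr IHb -mulnA subnDA.
Qed.

Section BadRowsBound.
Variables (R : realType) (V : finType) (H : {set {set V}}) (k l m' w d : nat).
Local Notation m := m'.+1.
Local Notation D := (k - l)%N.
Local Notation rows := ({ffun 'I_m -> V}).
Local Notation slots := ({ffun 'I_w * 'I_D -> 'I_m}).
Variables (p delta beta : R) (i0 : 'I_m) (v : V).
Hypothesis Hk : uniform k H.
Hypothesis forced : degree_forces_pm m k l d.
Hypotheses (w0 : (0 < w)%N) (wD : (w * D <= m - l - 1)%N) (lm : (l < m)%N).
Hypotheses (hp : 0 <= p <= 1) (delta0 : 0 <= delta) (theta0 : 0 < p - delta).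
Hypothesis hbeta : 0 < beta <= 1.
Hypothesis d_small :
  (d * D`!)%:R <= (1 - beta) * (p - delta) * ((m - l - 1) ^_ D)%:R.
Implicit Types (J : {set 'I_m}) (x : rows) (s : slots).

Let cardJ J : #|J| = l -> (m - l - 1 <= #|~: (i0 |: J)|)%N.
Proof.
move=> cJ; have := cardsC (i0 |: J); rewrite card_ord.
have : (#|i0 |: J| <= l.+1)%N by rewrite cardsU1 cJ; case: (i0 \notin J).
by move: #|i0 |: J| #|~: (i0 |: J)| => a b; clear; lia.
Qed.

(** First moment: small degree of [J] makes the average proportion of linked groups at most (1 -
    beta)(p - delta), whereas a sloting that is not poor has proportion above p - delta. By Markov's
    inequality these are at most a fraction 1 - beta. *)
Lemma many_poor_slotings J x : injective x -> #|J| = l ->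
  (degree (pull_back H x) J < d)%N ->
  beta * #|slotings k l w i0 J|%:R
    <= #|[set s in slotings k l w i0 J | poor H p delta J s x]|%:R.
Proof.
move=> injx cJ degJ; set S := slotings k l w i0 J; set M := #|~: (i0 |: J)|.
have DM : (D <= w * D)%N by rewrite leq_pmull.
have wM : (w * D <= M)%N := leq_trans wD (cardJ cJ).
pose NP := [set s in S | ~~ poor H p delta J s x].
have cS : #|S| = (#|[set s in S | poor H p delta J s x]| + #|NP|)%N.
  rewrite -(cardsID [set s | poor H p delta J s x] S); congr (_ + _)%N.
    by apply: eq_card => s; rewrite finset.in_setI !finset.in_set.
  by apply: eq_card => s; rewrite finset.in_setD /NP !finset.in_set andbC.
have cSM : #|S| = (M ^_ D * (M - D) ^_ (w * D - D))%N.
  by rewrite /S card_slotings -ffactD subnKC.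
have M0 : 0 < (M ^_ D)%:R :> R by rewrite ltr0n ffact_gt0 (leq_trans DM).
have wR : 0 < w%:R :> R by rewrite ltr0n.
have H1 : (p - delta) * w%:R * #|NP|%:R <=
    w%:R * ((d * D`!) * (M - D) ^_ (w * D - D))%:R.
  apply: (@le_trans _ _ (\sum_(s in S)
    #|[set g | read s x g \in link H k l (x @: J)]|%:R)).
    rewrite mulrC mulr_natl -sumr_const big_mkcond [leRHS]big_mkcond.
    apply: ler_sum => s _; rewrite finset.in_set; case: (s \in S) => //=.
    by case: ifP => // np; rewrite ltW // ltNge np.
  rewrite -natr_sum -natrM ler_nat (leq_trans (sum_linked_groups H k l w i0 x J)) //.
  rewrite leq_mul2l leq_mul2r; apply/orP; right; apply/orP; right.
  apply: leq_trans (card_linked_slots Hk injx cJ) _.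
  by rewrite leq_mul2r (ltnW degJ) orbT.
have H2 : #|NP|%:R <= (1 - beta) * #|S|%:R.
  rewrite -(ler_pM2l (mulr_gt0 (mulr_gt0 theta0 wR) M0)).
  rewrite [leLHS]mulrAC; apply: le_trans (ler_wpM2r (ltW M0) H1) _.
  rewrite -[leLHS]mulrA -natrM -mulnA [((M - D) ^_ _ * _)%N]mulnC -cSM natrM.
  have b1 : 0 <= (1 - beta) * (p - delta).
    by case/andP: hbeta => ? ?; rewrite mulr_ge0 ?(ltW theta0) ?subr_ge0.
  have dM : (d * D`!)%:R <= (1 - beta) * (p - delta) * (M ^_ D)%:R.
    apply: le_trans d_small _; rewrite ler_wpM2l // ler_nat; apply: leq_ffact;
      exact: cardJ.
  have SR : 0 <= w%:R * #|S|%:R :> R by rewrite mulr_ge0.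
  have := ler_wpM2r SR dM; congr (_ <= _); ring.
have : #|S|%:R = #|[set s in S | poor H p delta J s x]|%:R + #|NP|%:R :> R.
  by rewrite cS natrD.
lra.
Qed.

(** Double counting of (row, sloting): a bad row has some [J] with at least a fraction beta of poor
    slotings, while for each sloting poor rows are exponentially rare by [card_poor]. The binomial
    is the union bound over [J]. *)
Lemma card_bad_rows :
  (forall L : {set V}, #|L| = l -> p * (#|V| ^ D)%:R <= #|link H k l L|%:R) ->
  #|bad_rows [set: V] (matchable H) i0 v|%:R
    <= 'C(m, l)%:R / beta * expR (- (delta ^+ 2 / 4) * w%:R) * (#|V| ^ m')%:R.
Proof.
move=> linkp; have /andP[beta0 beta1] := hbeta.
pose S J := slotings k l w i0 J.
pose X J : {set rows} := [set x : rows | [&& injectiveb x, x i0 == v &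
   beta * #|S J|%:R <= #|[set s in S J | poor H p delta J s x]|%:R]].
have sub : bad_rows [set: V] (matchable H) i0 v \subset
    \bigcup_(J : {set 'I_m} | #|J| == l) X J.
  apply/fintype.subsetP => x; rewrite finset.in_set =>
    /and4P[/injectiveP injx _ xv bad].
  have [J cJ dJ] := bad_row_poor_set Hk (ltnW lm) forced injx bad.
  apply/finset.bigcupP; exists J; first by rewrite cJ.
  rewrite finset.in_set; apply/and3P; split=> //; first exact/injectiveP.
  exact: many_poor_slotings.
have cX J : #|J| = l ->
   #|X J|%:R <= beta^-1 * expR (- (delta ^+ 2 / 4) * w%:R) * (#|V| ^ m')%:R.
  move=> cJ; have S0 : 0 < #|S J|%:R :> R.
    by rewrite ltr0n card_slotings ffact_gt0 (leq_trans wD) // cardJ.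
  rewrite -mulrA ler_pdivlMl // -(ler_pM2r S0).
  apply: (@le_trans _ _ (\sum_(x : rows | injectiveb x && (x i0 == v))
      #|[set s in S J | poor H p delta J s x]|%:R)).
    rewrite mulrAC mulr_natr -sumr_const big_mkcond [leRHS]big_mkcond.
    apply: ler_sum => x _; rewrite finset.in_set andbA; case: (injectiveb x &&
      _) => //=.
    by case: ifP.
  rewrite -natr_sum.
  have -> : (\sum_(x : rows | injectiveb x &&
    (x i0 == v)) #|[set s in S J | poor H p delta J s x]|
     = \sum_(s in S J) #|[set x : rows | [&& injectiveb x,
       x i0 == v & poor H p delta J s x]]|)%N.
    transitivity (\sum_(x : rows | injectiveb x && (x i0 == v))
        \sum_(s | (s \in S J) && poor H p delta J s x) 1)%N.
      apply: eq_bigr => x _; rewrite -sum1_card; apply: eq_bigl => s.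
      by rewrite finset.in_set.
    rewrite (exchange_big_dep (fun s => s \in S J)) /=; last by move=>
      x s _ /andP[].
    apply: eq_bigr => s sS; rewrite -sum1dep_card; apply: eq_bigl => x.
    by rewrite sS /= andbA.
  rewrite natr_sum mulrC mulr_natl -sumr_const; apply: ler_sum => s sS.
  have [injs sJ] := slotingsP sS.
  by rewrite mulrC; apply: card_poor.
apply: (@le_trans _ _ (\sum_(J : {set 'I_m} | #|J| == l) #|X J|%:R)).
  rewrite -natr_sum ler_nat; apply: leq_trans (subset_leq_card sub) _.
  exact: card_bigcup_le.
apply: (@le_trans _ _ (\sum_(J : {set 'I_m} | #|J| == l)
   beta^-1 * expR (- (delta ^+ 2 / 4) * w%:R) * (#|V| ^ m')%:R)).
  by apply: ler_sum => J /eqP; exact: cX.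
rewrite sumr_const -[leLHS]mulr_natl !mulrA.
have := cards_draws [set: 'I_m] l; rewrite cardsT card_ord => <-.
rewrite le_eqVlt; apply/orP; left; apply/eqP; congr (_%:R * _ * _ * _).
by apply: eq_card => J; rewrite finset.in_set finset.subsetT.
Qed.

End BadRowsBound.

(** * Asymptotics and the Dirac threshold *)

Section Asymptotics.
Variable R : realType.

Lemma nat_above (x : R) : exists n0 : nat, forall n : nat, (n0 <= n)%N -> x <=
  n%:R.
Proof.
exists (Num.bound `|x|) => n le.
apply: le_trans (ler_norm x) _; apply: ltW;
  apply: lt_le_trans (archi_boundP _) _ => //.
by rewrite ler_nat.
Qed.

Lemma ffact_asymp (a D : nat) (t : R) : 0 < t ->
  exists n0 : nat, forall n : nat, (n0 <= n)%N ->
    (n ^ D)%:R <= (1 + t) * ((n - a) ^_ D)%:R.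
Proof.
move=> t0; pose c := (a + D)%N.
have [n0 Hn0] := nat_above ((1 + t) * (D * c)%:R / t).
exists (maxn c n0) => n; rewrite geq_max => /andP[cn /Hn0 nn].
case: D @c cn nn {Hn0} => [|D] c cn nn; first by rewrite ffactn0 expn0; lra.
have H1 : ((n - c) ^ D.+1 <= (n - a) ^_ D.+1)%N.
  rewrite ffact_prod -[X in (_ ^ X)%N]card_ord -prod_nat_const.
  by apply: leq_prod => i _; rewrite -subnDA leq_sub2l // leq_add2l ltnW.
have := expn_sub_bound D.+1 (leq_subr c n); rewrite subKn //=.
rewrite -(ler_nat R) natrD => H2.
have H3 : (1 + t) * (D.+1 * c * n ^ D)%:R <= t * (n ^ D.+1)%:R.
  rewrite ler_pdivrMr // [leRHS]mulrC in nn.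
  by rewrite natrM mulrA expnS [leRHS](congr1 _ (natrM _ _ _))
    [leRHS]mulrA ler_wpM2r.
have t1 : 0 <= 1 + t by lra.
apply: le_trans (ler_wpM2l t1 (_ : ((n - c) ^ D.+1)%:R <= _));
  last by rewrite ler_nat.
have := ler_wpM2l t1 H2; rewrite mulrDr; lra.
Qed.

(** Use e^y >= (y / j)^j with j = l + 2; the spare power of n absorbs [B]. *)
Lemma expR_poly (a B : R) (l D : nat) : 0 < a -> (0 < D)%N ->
  exists n0 : nat, forall n : nat, (n0 <= n)%N ->
    B * (n ^ l.+1)%:R <= expR (a * ((n - l - 1) %/ D)%:R).
Proof.
move=> a0 D0; pose j := l.+2; pose c : R := (a / (2 * D * j)%:R) ^+ j.
have c0 : 0 < c by rewrite exprn_gt0 // divr_gt0 // ltr0n !muln_gt0 D0.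
have [n0 Hn0] := nat_above (B / c); exists (maxn n0 (2 * (l + 1 + D))) => n.
rewrite geq_max => /andP[/Hn0 nn nl].
set w := ((n - l - 1) %/ D)%N.
have wn : (n <= 2 * D * w)%N.
  have := divn_eq (n - l - 1) D; have := ltn_pmod (n - l - 1) D0; rewrite -/w.
  by rewrite -mulnA [(D * w)%N]mulnC; move: (w * D)%N => y; lia.
have -> : a * w%:R = (a * w%:R / j%:R) * j%:R by rewrite divfK // pnatr_eq0.
rewrite expRM_natr; apply: (@le_trans _ _ ((a * w%:R / j%:R) ^+ j)); last first.
  have y0 : 0 <= a * w%:R / j%:R by rewrite divr_ge0 // mulr_ge0 // ltW.
  rewrite lerXn2r ?nnegrE ?expR_ge0 //.
  by apply: le_trans (expR_ge1Dx _); rewrite lerDr.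
apply: (@le_trans _ _ (c * (n ^ j)%:R)).
  rewrite [(n ^ j)%N]expnSr natrM mulrCA mulrC ler_wpM2l //.
  by rewrite mulrC -ler_pdivrMr.
rewrite natrX -exprMn lerXn2r ?nnegrE ?mulr_ge0 ?divr_ge0 ?(ltW a0) //.
apply: (@le_trans _ _ (a / (2 * D * j)%:R * (2 * D * w)%:R)).
  by rewrite ler_wpM2l ?ler_nat // divr_ge0 // ltW.
have j0 : j%:R != 0 :> R by rewrite pnatr_eq0.
have D0R : D%:R != 0 :> R by rewrite pnatr_eq0 -lt0n.
rewrite !natrM; move: (j%:R) j0 => z z0.
by rewrite le_eqVlt; apply/orP; left; apply/eqP; field; rewrite z0 D0R.
Qed.

End Asymptotics.

Lemma spread_matchings_le (R : realType) (V : finType) (q q' : R)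
    (H : {set {set V}}) (A : {set V}) :
  0 <= q -> q <= q' -> spread_matchings q H A -> spread_matchings q' H A.
Proof.
move=> q0 qq' [mu [mu0 muM mu1 muq]]; exists mu; split=> // T.
apply: le_trans (muq T) _; rewrite lerXn2r ?nnegrE //.
exact: le_trans qq'.
Qed.

(** Take N = n / m blocks; the remainder n mod m is a multiple of k. The 16 becomes the 8 of the
    switching argument since n^m' <= 2 (N * m)^m', and n <= 2mN converts N into n in the spread. *)
Lemma near_complete_spread (R : realType) (k m' : nat)
  : (0 < k)%N -> (k %| m'.+1)%N ->
  exists2 C : R, 0 < C & exists n0 : nat, forall n : nat, (n0 <=
    n)%N -> (k %| n)%N ->
    forall H : {set {set 'I_n}}, uniform k H ->
    (forall (i0 : 'I_m'.+1) v,
       (16 * m'.+1 * #|bad_rows [set: 'I_n] (matchable H) i0 v| <= n ^ m')%N) ->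
    spread_matchings (C / n%:R ^+ (k - 1)) H [set: 'I_n].
Proof.
move=> k0 km; set m := m'.+1.
exists ((edge_spread_const m' k)%:R * (2 * m)%:R ^+ (k - 1)).
  rewrite mulr_gt0 ?exprn_gt0 ?ltr0n //.
  by rewrite /edge_spread_const /spread_const expn_gt0 !muln_gt0 expn_gt0.
have [n1 Hn1] := @ffact_asymp R m m' 1 ltr01.
exists (maxn n1 (8 * m * m * m)) => n; rewrite geq_max =>
  /andP[/Hn1 nn1 nm] kn H Hk few.
set N := (n %/ m)%N.
have N_large : (8 * m * m <= N)%N by rewrite leq_divRL.
have N0 : (0 < N)%N by apply: leq_trans N_large.
have nN : (n <= N * m + m)%N.
  by rewrite {1}(divn_eq n m) leq_add2l ltnW // ltn_pmod.
have kN : (k %| n %% m)%N.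
  by rewrite -(dvdn_addr _ (dvdn_mull N km)) -divn_eq.
have cA : #|[set: 'I_n]| = (N * m + k * (n %% m %/ k))%N.
  by rewrite cardsT card_ord [(k * _)%N]mulnC divnK // /N -divn_eq.
have pN : (n ^ m' <= 2 * (N * m) ^ m')%N.
  rewrite -(ler_nat R) natrM; apply: le_trans nn1 _.
  rewrite (_ : 1 + 1 = 2%:R) // ler_wpM2l // ler_nat.
  apply: (@leq_trans ((n - m) ^ m')).
    rewrite ffact_prod -[X in (_ <= _ ^ X)%N]card_ord -prod_nat_const.
    by apply: leq_prod => i _; rewrite leq_subr.
  have : (n - m <= N * m)%N by rewrite leq_subLR addnC.
  by case: (m') => // j; rewrite leq_exp2r.
have fewK (i0 : 'I_m) v : v \in [set: 'I_n] ->
    (#|bad_rows [set: 'I_n] (matchable H) i0 v| <= (N * m) ^ m' %/ (8 * m))%N.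
  move=> _; rewrite leq_divRL // mulnC.
  by rewrite -(leq_pmul2l (ltn0Sn 1)) mulnA (leq_trans _ pN) // mulnA few.
have Ks : (8 * m * ((N * m) ^ m' %/ (8 * m)) <= (N * m) ^ m')%N.
  by rewrite mulnC leq_divM.
have := rest_spread_matchings R k0 Hk cA fewK Ks N_large.
apply: spread_matchings_le; first by rewrite divr_ge0 ?exprn_ge0.
have n0 : (0 < n)%N by apply: leq_trans nm; rewrite !muln_gt0.
rewrite -subn1 -[leRHS]mulrA ler_wpM2l // ler_pdivlMr ?exprn_gt0 ?ltr0n //.
rewrite mulrC ler_pdivrMr ?exprn_gt0 ?ltr0n // -exprMn lerXn2r ?nnegrE //.
rewrite -natrM ler_nat; apply: leq_trans nN _; have := leq_pmull m N0.
by lia.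
Qed.

(** A random m-set inherits degree density above [X], enough to force a perfect matching. The
    failure bound is of order m^l exp(-t^2 w / 4) with w about m / (k - l), so m large brings it
    below 1 / (16m). *)
Lemma few_bad_rows (R : realType) (k l : nat) (eps : R) :
  0 < eps -> (l < k)%N ->
  exists m0 : nat, forall m' : nat, (m0 <= m'.+1)%N -> forall X : R, 0 <= X ->
    (pm_degree m'.+1 k l)%:R <= X * 'C(m'.+1, k - l)%:R ->
  exists n0 : nat, forall n : nat, (n0 <= n)%N ->
    forall H : {set {set 'I_n}}, uniform k H ->
    (X + eps) * 'C(n, k - l)%:R <= (min_degree l H)%:R ->
    forall (i0 : 'I_m'.+1) v,
       (16 * m'.+1 * #|bad_rows [set: 'I_n] (matchable H) i0 v| <= n ^ m')%N.
Proof.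
move=> eps0 lk; set D := (k - l)%N; have D0 : (0 < D)%N by rewrite subn_gt0.
pose t := eps / 4; have t0 : 0 < t by rewrite divr_gt0.
have a0 : 0 < t ^+ 2 / 4 by rewrite divr_gt0 ?exprn_gt0.
have [m1 Hm1] := ffact_asymp (l + 1) D t0.
have [m2 Hm2] := expR_poly (16 / (eps / 8)) l a0 D0.
exists (maxn (maxn m1 m2) (l + D + 2)) => m'; set m := m'.+1.
rewrite !geq_max => /andP[/andP[/Hm1 m_m1 /Hm2 m_m2] mlD] X X0 pmX.
have [n1 Hn1] := ffact_asymp 0 D t0.
exists (maxn n1 (l + D)) => n; rewrite geq_max =>
  /andP[/Hn1 n_n1 nlD] H Hk minH i0 v.
rewrite subn0 in n_n1.
have degH (L : {set 'I_n}) : #|L| = l -> (min_degree l H <= degree H L)%N.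
  have lV : (l <= #|'I_n|)%N by rewrite card_ord (leq_trans _ nlD) // leq_addr.
  by move: L; apply/(leq_min_degreeP (min_degree l H) H lV).
have linkH (L : {set 'I_n}) : #|L| = l -> (X + eps) * (n ^_ D)%:R <=
  #|link H k l L|%:R.
  move=> cL; apply: (@le_trans _ _ (degree H L * D`!)%:R);
    last by rewrite ler_nat card_link.
  rewrite -bin_ffact !natrM mulrA ler_wpM2r //; apply: le_trans minH _.
  by rewrite ler_nat degH.
have nD0 : 0 < (n ^_ D)%:R :> R by rewrite ltr0n ffact_gt0 (leq_trans _ nlD) //
  leq_addl.
(* A link has at most n^D tuples; this bound makes p at most 1. *)
have Xt : X + eps <= 1 + t.
  have [|L _ cL] := @subset_of_card 'I_n [set: 'I_n] l.
    by rewrite cardsT card_ord (leq_trans _ nlD) // leq_addr.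
  rewrite -(ler_pM2r nD0); apply: le_trans (linkH L cL) _; apply: le_trans n_n1.
  by rewrite ler_nat (leq_trans (max_card _)) // card_ffun !card_ord.
have et : eps = 4 * t by rewrite /t; field.
(* Of eps = 4t, one t pays for n^D against the falling factorial, one is the deviation in
   [chernoff], and the other two absorb [X * t] and beta = t/2. *)
pose p := X + 3 * t.
have pE : p = X + 3 * t by [].
have hp : 0 <= p <= 1 by rewrite pE; lra.
have link_p (L : {set 'I_n}) : #|L| = l -> p * (#|'I_n| ^ D)%:R <=
  #|link H k l L|%:R.
  move=> cL; rewrite card_ord; apply: le_trans (linkH L cL).
  have p0 : 0 <= p by case/andP: hp.
  apply: le_trans (ler_wpM2l p0 n_n1) _; rewrite mulrA ler_wpM2r //.
  have pt : p * t <= t by rewrite ler_piMl ?(ltW t0) //; case/andP: hp.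
  by rewrite mulrDr mulr1; lra.
have forced : degree_forces_pm m k l (pm_degree m k l).
  by rewrite /pm_degree; case: ex_minnP.
set w := ((m - l - 1) %/ D)%N.
have wD : (w * D <= m - l - 1)%N by exact: leq_divM.
have w0 : (0 < w)%N by rewrite divn_gt0 //; move: mlD; rewrite -/m; clear; lia.
have lm : (l < m)%N by move: mlD; clear; lia.
have hbeta : 0 < eps / 8 <= 1 by move: hp; rewrite pE; lra.
have theta0 : 0 < p - t by rewrite pE; lra.
have dsm : (pm_degree m k l * D`!)%:R <=
  (1 - eps / 8) * (p - t) * ((m - l - 1) ^_ D)%:R.
  rewrite natrM; apply: le_trans (ler_wpM2r _ pmX) _ => //.
  rewrite -[leLHS]mulrA -natrM bin_ffact;
    apply: (@le_trans _ _ (X * ((1 + t) * ((m - l - 1) ^_ D)%:R))).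
    rewrite ler_wpM2l //; rewrite subnDA in m_m1; apply: le_trans m_m1;
      rewrite ler_nat.
    rewrite ffact_prod -[X in (_ <= _ ^ X)%N]card_ord -prod_nat_const.
    by apply: leq_prod => i _; rewrite leq_subr.
  rewrite mulrA ler_wpM2r //.
  have : X * t <= t by rewrite ler_piMl ?(ltW t0) //; move: hp; rewrite pE; lra.
  have : t / 2 * (p - t) <= t / 2.
    by rewrite ler_piMr ?divr_ge0 ?(ltW t0) //; lra.
  have -> : eps / 8 = t / 2 by rewrite et; field.
  have -> : X * (1 + t) = X + X * t by ring.
  have -> : (1 - t / 2) * (p - t) = p - t - t / 2 * (p - t) by ring.
  by move: t0; clear -pE; lra.
have main := card_bad_rows i0 v Hk forced w0 wD lm hp (ltW t0)
  theta0 hbeta dsm link_p.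
rewrite -(ler_nat R) natrM; apply: le_trans (ler_wpM2l _ main) _ => //.
rewrite card_ord mulrA ler_piMl //.
rewrite mulrA mulNr expRN ler_pdivrMr ?expR_gt0 // mul1r; apply: le_trans m_m2.
rewrite expnSr !natrM.
have Cm : ('C(m, l))%:R <= (m ^ l)%:R :> R.
  rewrite ler_nat; apply: (@leq_trans (m ^_ l)).
    by rewrite -bin_ffact leq_pmulr // fact_gt0.
  rewrite ffact_prod -[X in (_ <= _ ^ X)%N]card_ord -prod_nat_const.
  by apply: leq_prod => i _; rewrite leq_subr.
rewrite [leRHS](_ : _ = 16 * m%:R * ((m ^ l)%:R / (eps / 8))); last by ring.
rewrite ler_wpM2l ?mulr_ge0 // ler_wpM2r // invr_ge0 ltW //.
by case/andP: hbeta.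
Qed.

(** The limit is the infimum of the eventual upper bounds, that is, the upper limit; every late
    [a j] plus e is such a bound. *)
Lemma cvg_of_eventually_le (R : realType) (a : nat -> R) :
  (forall i, 0 <= a i) ->
  (forall e, 0 < e -> exists J : nat, forall j, (J <= j)%N ->
     exists I : nat, forall i, (I <= i)%N -> a i <= a j + e) ->
  exists L : R, (a x @[x --> \oo] --> L)%classic.
Proof.
move=> a0 ha.
pose S : set R := (fun x => exists I : nat, forall i, (I <= i)%N -> a i <= x).
have [J1 H1] := ha 1 ltr01; have [I1 HI1] := H1 _ (leqnn J1).
have S0 : (S !=set0)%classic by exists (a J1 + 1); exists I1.
have Sb : has_lbound S by exists 0 => x [I HI];
  apply: le_trans (HI I (leqnn I)).
exists (inf S); apply/cvgrPdist_lt => e e0.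
have [x [I HI] xe] := inf_adherent e0 (conj S0 Sb).
have e20 : 0 < e / 2 by rewrite divr_gt0.
have [J HJ] := ha _ e20; exists (maxn I J) => // i /=.
rewrite geq_max => /andP[/HI ix /HJ iS].
have := ge_inf Sb iS; rewrite ltr_norml; lra.
Qed.

Lemma pm_degree_gt0 (n k l : nat) : (0 < n)%N -> (l <=
  n)%N -> (0 < pm_degree n k l)%N.
Proof.
move=> n0 ln; rewrite /pm_degree; case: ex_minnP => d Hd _; rewrite lt0n.
apply/eqP => d0; move: Hd; rewrite d0 => /forallP/(_ finset.set0)/implyP.
have -> : uniform k (finset.set0 : {set {set 'I_n}}).
  by apply/forall_inP => e; rewrite inE.
move=> /(_ isT)/existsP[M /and3P[]]; rewrite finset.subset0 => /eqP -> _.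
rewrite /finset.cover finset.big_set0 => /eqP/setP/(_ (Ordinal n0)).
by rewrite !inE.
Qed.

Lemma pm_degree_pred (n k l : nat) : (0 < pm_degree n k l)%N ->
  exists H : {set {set 'I_n}}, [/\ uniform k H,
    ((pm_degree n k l).-1 <= min_degree l H)%N & ~~ has_perfect_matching H].
Proof.
rewrite /pm_degree; case: ex_minnP => d Hd dmin d0.
have /forallPn[H] : ~~ degree_forces_pm n k l d.-1.
  by apply/negP => /dmin; case: d d0 {Hd dmin} => // d _; rewrite ltnn.
by rewrite negb_imply => /andP[/andP[Hk minH] noH]; exists H.
Qed.

Lemma spread_matchings_pm (R : realType) (V : finType) (q : R)
  (H : {set {set V}}) :
  spread_matchings q H [set: V] -> has_perfect_matching H.
Proof.
case=> mu [_ muM mu1 _]; have [S /muM SM] : exists S, mu S != 0.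
  apply/existsP; apply: contra_eqT mu1; rewrite negb_exists => /forallP h.
  rewrite /mass big1 => [|S _]; first by rewrite eq_sym oner_neq0.
  by apply/eqP; have := h S; rewrite negbK.
by apply/existsP; exists S.
Qed.

(** * Convergence of the thresholds and spread at the threshold *)

Section DiracThreshold.
Variables (R : realType) (k l : nat).
Hypotheses (l0 : (0 < l)%N).

Let a (i : nat) : R := (pm_degree (i * k) k l)%:R / 'C(i * k, k - l)%:R.

(* A spread measure on perfect matchings in particular produces one, so the   *)
(* sampling argument also compares t(n, k, l) with t(m, k, l), which is what  *)
(* makes the normalised thresholds converge.                                  *)
Lemma dirac_threshold_cvg : (l < k)%N ->
  (a x @[x --> \oo] --> dirac_threshold R l k)%classic.
Proof.
move=> lk; have k0 : (0 < k)%N := leq_ltn_trans (leq0n l) lk.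
suff [L aL] : exists L : R, (a x @[x --> \oo] --> L)%classic.
  by rewrite /dirac_threshold (cvg_lim _ aL).
apply: cvg_of_eventually_le => [i|e e0]; first by rewrite divr_ge0.
have e20 : 0 < e / 2 by rewrite divr_gt0.
have [m0 Hm0] := few_bad_rows e20 lk.
exists (maxn m0 1) => j; rewrite geq_max => /andP[jm j0].
have jk0 : (0 < j * k)%N by rewrite muln_gt0 j0.
case E : (j * k)%N jk0 => [//|m'] _.
have m0m : (m0 <= m'.+1)%N by rewrite -E (leq_trans jm) // leq_pmulr.
have km : (k %| m'.+1)%N by rewrite -E dvdn_mull.
have aj : (pm_degree m'.+1 k l)%:R <= a j * 'C(m'.+1, k - l)%:R.
  rewrite /a E divfK // pnatr_eq0 -lt0n bin_gt0 (leq_trans (leq_subr l k)) //.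
  by rewrite -E leq_pmull.
have aj0 : 0 <= a j by rewrite divr_ge0.
have [n1 Hn1] := Hm0 _ m0m _ aj0 aj.
have [C C0 [n2 Hn2]] := near_complete_spread R k0 km.
have [n3 Hn3] := ffact_asymp 0 (k - l) (@ltr01 R).
have [n4 Hn4] := nat_above (4 / e * (k - l)`!%:R).
exists (maxn (maxn n1 n2) (maxn n3 (maxn n4 1))) => i.
rewrite !geq_max => /andP[/andP[in1 in2] /and3P[in3 in4 i0]].
have ik b : (b <= i)%N -> (b <= i * k)%N.
  by move=> le; apply: leq_trans le _; rewrite leq_pmulr.
set n := (i * k)%N; have kn : (k <= n)%N by rewrite leq_pmull.
have C1 : 0 < 'C(n, k - l)%:R :> R.
  by rewrite ltr0n bin_gt0 (leq_trans _ kn) // leq_subr.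
have pd0 : (0 < pm_degree n k l)%N.
  by rewrite pm_degree_gt0 // ?muln_gt0 ?i0 // (leq_trans _ kn) // ltnW.
have [H [Hk minH noH]] := pm_degree_pred pd0.
have lt : (min_degree l H)%:R < (a j + e / 2) * 'C(n, k - l)%:R.
  rewrite ltNge; apply/negP => le; case/negP: noH.
  apply: (@spread_matchings_pm R _ (C / n%:R ^+ (k - 1))).
  apply: Hn2 => //; [exact: ik|exact: dvdn_mull|].
  by apply: Hn1 => //; exact: ik.
(* The extremal hypergraph has minimum degree at least [pm_degree] minus one; a large binomial makes
   this one negligible after normalisation. *)
have big : 2 / e <= 'C(n, k - l)%:R.
  have F0 : 0 < (k - l)`!%:R :> R by rewrite ltr0n fact_gt0.
  have h1 : n%:R <= (n ^ (k - l))%:R :> R.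
    rewrite ler_nat -[X in (X <= _)%N]expn1 leq_pexp2l ?muln_gt0 ?i0 //.
    by rewrite subn_gt0.
  have := Hn3 n (ik _ in3); rewrite subn0 -bin_ffact natrM mulrA => h2.
  have := Hn4 n (ik _ in4) => h4.
  have := le_trans h4 (le_trans h1 h2); rewrite ler_pM2r //; lra.
have le : (pm_degree n k l)%:R <= (min_degree l H)%:R + 1 :> R.
  by rewrite natr1 ler_nat -(prednK pd0) ltnS.
rewrite [a i]/a -/n ler_pdivrMr //.
have : 1 <= e / 2 * 'C(n, k - l)%:R.
  have := ler_wpM2l (ltW e20) big; rewrite (_ : e / 2 * (2 / e) = 1) //.
  by field; rewrite gt_eqF.
move=> h; apply: le_trans le _; have := ltW lt; rewrite !mulrDl; move: h.
have -> : e * 'C(n, k - l)%:R = e / 2 * 'C(n, k - l)%:R + e / 2 * 'C(n,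
  k - l)%:R by field.
lra.
Qed.

Lemma dirac_threshold_ge0 : 0 <= dirac_threshold R l k.
Proof.
(* For a divergent sequence [limn] is the default point 0. *)
rewrite /dirac_threshold; case: (pselect (cvgn a)) => [ca|/dvgP E].
  by apply: limr_ge => //; apply: nearW => i; rewrite divr_ge0.
by rewrite E.
Qed.

(** For l < k, fix m = j * k so late that its normalised degree is below the threshold plus eps / 2;
    the other half is the margin for sampling. For l = k positive degree means that every k-set is
    an edge, so m = k has no bad rows. *)
Lemma dirac_spread (eps : R) : 0 < eps -> (l <= k)%N ->
  exists2 C : R, 0 < C & exists n0 : nat, forall n : nat, (n0 <=
    n)%N -> (k %| n)%N ->
    forall H : {set {set 'I_n}}, uniform k H ->
    (dirac_threshold R l k + eps) * 'C(n, k - l)%:R <= (min_degree l H)%:R ->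
    spread_matchings (C / n%:R ^+ (k - 1)) H [set: 'I_n].
Proof.
move=> eps0; have thr0 := dirac_threshold_ge0; rewrite leq_eqVlt =>
  /predU1P[lk|lk].
  have k0 : (0 < k)%N by rewrite -lk.
  case E : k k0 => [//|m'] _.
  have [C C0 [n0 Hn0]] := near_complete_spread R (ltn0Sn m') (dvdnn m'.+1).
  exists C => //; exists (maxn n0 k) => n; rewrite geq_max =>
    /andP[nn0 kn] dn H Hk.
  have lE : l = m'.+1 by rewrite lk.
  rewrite E in kn thr0; rewrite lE in thr0 * => minH; apply: Hn0 => // i0 v.
  rewrite (_ : bad_rows _ _ _ _ = finset.set0) ?cards0 ?muln0 //.
  apply/setP => x; rewrite finset.in_set finset.in_set0.
  apply/negP => /and4P[/injectiveP injx _ _ /negP]; apply; set S :=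
    [set x i | i : 'I_m'.+1].
  have cS : #|S| = m'.+1 by rewrite card_imset // card_ord.
  have SH : S \in H.
    have : (0 < min_degree m'.+1 H)%N.
      rewrite -(ltr0n R); apply: lt_le_trans minH.
      by rewrite mulr_gt0 ?ltr0n ?bin_gt0 ?subnn //; lra.
    move=> /(leq_min_degreeP 1 H (_ : (m'.+1 <= #|'I_n|)%N)) h.
    have : (m'.+1 <= #|'I_n|)%N by rewrite card_ord.
    move=> /h/(_ S cS)/card_gt0P[e]; rewrite inE => /andP[eH Se].
    suff -> : S = e by [].
    by apply/eqP; rewrite eqEcard Se cS (eqP (forall_inP Hk e eH)) ?E leqnn.
  apply/existsP; exists [set S]; apply/and3P; split.
  - by rewrite finset.sub1set.
  - by apply/finset.trivIsetP => A B; rewrite !inE => /eqP -> /eqP ->;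
    rewrite eqxx.
  - by rewrite /finset.cover finset.big_set1.
have k0 : (0 < k)%N := leq_ltn_trans (leq0n l) lk.
have e20 : 0 < eps / 2 by rewrite divr_gt0.
have [m0 Hm0] := few_bad_rows e20 lk.
have /cvgrPdist_lt/(_ _ e20)[j0 _ Hj0] := dirac_threshold_cvg lk.
pose j := maxn j0 (maxn m0 1).
have := Hj0 j (leq_maxl _ _); rewrite ltr_norml => /andP[aj _].
have jk0 : (0 < j * k)%N by rewrite muln_gt0 k0 andbT /j !leq_max /= !orbT.
have jm : (m0 <= j)%N by rewrite /j !leq_max leqnn orbT.
case E : (j * k)%N jk0 => [//|m'] jk0.
have m0m : (m0 <= m'.+1)%N by rewrite -E (leq_trans jm) // leq_pmulr.
have km : (k %| m'.+1)%N by rewrite -E dvdn_mull.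
have paj : (pm_degree m'.+1 k l)%:R <= a j * 'C(m'.+1, k - l)%:R.
  rewrite /a E divfK // pnatr_eq0 -lt0n bin_gt0 (leq_trans (leq_subr l k)) //.
  by rewrite dvdn_leq.
have aj0 : 0 <= a j by rewrite divr_ge0.
have [n1 Hn1] := Hm0 _ m0m _ aj0 paj.
have [C C0 [n2 Hn2]] := near_complete_spread R k0 km.
exists C => //; exists (maxn n1 n2) => n; rewrite geq_max =>
  /andP[nn1 nn2] kn H Hk minH.
apply: Hn2 => //; apply: Hn1 => //; apply: le_trans minH.
by rewrite ler_wpM2r //; lra.
Qed.

End DiracThreshold.

(** * The random hypergraph *)

Section SpreadProbability.
Variables (R : realType) (V : finType).
Implicit Types (p q : R) (H : {set {set V}}) (P : pred {set {set V}}).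

Lemma random_sub_prob_sub p H P P' : 0 <= p <= 1 ->
  (forall W, P W -> P' W) -> random_sub_prob p H P <= random_sub_prob p H P'.
Proof.
move=> hp PP'; rewrite /random_sub_prob [leLHS]big_mkcond [leRHS]big_mkcond.
apply: ler_sum => W _; case: ifP => [/andP[-> /PP' ->] //|_].
by case: ifP => // _; exact: random_sub_weight_ge0.
Qed.

(** Sprinkling: the p'-random set is the union of a p-random set and an independent s-random one. *)
Lemma random_sub_prob_le p p' H P : 0 <= p -> p <= p' -> p' < 1 ->
  (forall W W' : {set {set V}}, W \subset W' -> P W -> P W') ->
  random_sub_prob p H P <= random_sub_prob p' H P.
Proof.
move=> p0 pp' p'1 Pup; pose s := (p' - p) / (1 - p).
have p1 : 0 < 1 - p by lra.
have hp : 0 <= p <= 1 by lra.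
have hs : 0 <= s <= 1 by apply/andP; split;
  rewrite /s ?divr_ge0 ?ler_pdivrMr //; lra.
have E : p' = 1 - (1 - p) * (1 - s).
  by rewrite /s; field; rewrite gt_eqF.
have indE (t : R) : random_sub_prob t H P =
    \sum_(W : {set {set V}} | W \subset H) random_sub_weight t H W * (P W)%:R.
  rewrite /random_sub_prob big_mkcondr; apply: eq_bigr => W _.
  by case: (P W); rewrite ?mulr1 ?mulr0.
rewrite !indE E -random_sub_union; apply: ler_sum => W WH.
rewrite -[leLHS]mul1r -[X in X * _](sum_random_sub_weight s H) mulr_suml.
apply: ler_sum => W' W'H; rewrite mulrA [X in X * _ <= _]mulrC.
rewrite ler_wpM2l ?mulr_ge0 ?random_sub_weight_ge0 // ler_nat.
by case: (boolP (P W)) => // /(Pup _ (W :|: W') (finset.subsetUl _ _)) ->.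
Qed.

Lemma random_sub_prob1 H P : P H -> 1 <= random_sub_prob (1 : R) H P.
Proof.
move=> PH; rewrite /random_sub_prob (bigD1 H) /= ?fintype.subxx ?PH //.
have -> : random_sub_weight (1 : R) H H = 1.
  by rewrite /random_sub_weight big1 // => e ->.
by rewrite lerDl sumr_ge0 // => W _; apply: random_sub_weight_ge0;
  rewrite ler01 lexx.
Qed.

Lemma sum_halves (i0 i : nat) : \sum_(j < i) 2^-1 ^+ (i0 + j) <=
  2 * 2^-1 ^+ i0 :> R.
Proof.
suff : \sum_(j < i) 2^-1 ^+ (i0 + j) = 2 * 2^-1 ^+ i0 - 2 * 2^-1 ^+ (i0 + i)
  :> R.
  by move=> ->; rewrite gerBl mulr_ge0 // exprn_ge0.
elim: i => [|i IHi]; first by rewrite big_ord0 addn0 subrr.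
by rewrite big_ord_recr /= IHi addnS exprS; field.
Qed.

End SpreadProbability.

Lemma ln2_ge (R : realType) : 2^-1 <= ln (2 : R).
Proof.
have := @expRN_le R 2^-1; rewrite invr_ge0 ler0n => /(_ isT) h.
rewrite -[X in X <= _]expRK ler_ln ?posrE ?expR_gt0 //.
rewrite -[2^-1 : R]opprK expRN -[leRHS]invrK lef_pV2 ?posrE ?expR_gt0 ?invr_gt0 //.
by apply: le_trans (expR_ge1Dx _); lra.
Qed.

Lemma ln_above (R : realType) (B : R) :
  exists n0 : nat, forall n : nat, (n0 <= n)%N -> B <= ln (n%:R : R).
Proof.
have [n0 Hn0] := nat_above (expR B); exists n0 => n /Hn0 le.
rewrite -[X in X <= _]expRK ler_ln // ?posrE ?expR_gt0 //.
exact: lt_le_trans (expR_gt0 _) le.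
Qed.

(** The 25 is 24 + 1: r <= 3 ln n rounds of density 8q, and one of density q ln n. Fixing [i0] first
    makes the sum of the round errors small; the last error B / ln n then vanishes as n grows. *)
Lemma spread_matchings_prob (R : realType) (k : nat) (C eta : R) :
  (0 < k)%N -> 0 < C -> 0 < eta ->
  exists n0 : nat, forall n : nat, (n0 <= n)%N -> forall H : {set {set 'I_n}},
    uniform k H -> spread_matchings (C / n%:R ^+ (k - 1)) H [set: 'I_n] ->
    1 - eta <= random_sub_prob (Num.min 1 (25 * C * ln n%:R / n%:R ^+ (k - 1)))
      H
                 (@has_perfect_matching _).
Proof.
move=> k0 C0 eta0; have [i0 Hi0] := nat_above (4 / eta).
pose B : R := 2 ^+ (2 ^ i0).
have [n1 Hn1] := ln_above (2 * B / eta).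
have [n2 Hn2] := ln_above (1 : R).
exists (maxn (maxn n1 n2) 1) => n; rewrite !geq_max =>
  /andP[/andP[/Hn1 ln1 /Hn2 ln2] n0].
move=> H Hk spH; have pmH := spread_matchings_pm spH.
have [mu [mu0 muM mu1 muq]] := spH.
have nk : 0 < n%:R ^+ (k - 1) :> R by rewrite exprn_gt0 // ltr0n.
set q := C / n%:R ^+ (k - 1) in muq *.
have q0 : 0 < q by rewrite divr_gt0.
set p := 25 * C * ln n%:R / n%:R ^+ (k - 1).
have pE : p = 25 * (q * ln n%:R) by rewrite /p /q; field; rewrite gt_eqF.
(* At density 1 the random hypergraph is [H], which has a perfect matching because it carries a
   spread measure. *)
case: (lerP 1 p) => [_|p1].
  by apply: le_trans (random_sub_prob1 _ pmH); rewrite gerBl ltW.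
(* Then 2^(i0 + r) >= n bounds the number of edges of any perfect matching. *)
pose r := (trunc_log 2 n).+1.
have nr : (n <= 2 ^ (i0 + r))%N.
  apply: leq_trans (ltnW (trunc_log_ltn n (isT : (1 < 2)%N))) _.
  by rewrite leq_pexp2l // leq_addl.
have rln : r%:R <= 3 * ln (n%:R : R).
  have : (2 ^ trunc_log 2 n)%:R <= n%:R :> R by rewrite ler_nat trunc_logP.
  rewrite natrX -ler_ln ?posrE ?exprn_gt0 ?ltr0n // lnXn //
    -[leLHS]mulr_natr => h.
  have h' := ler_wpM2r (ler0n R (trunc_log 2 n)) (ln2_ge R).
  by rewrite /r -natr1; have := le_trans h' h; lra.
have qln : 0 < q * ln n%:R by rewrite mulr_gt0 //; lra.
have qle : q <= q * ln n%:R by rewrite ler_pMr.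
pose p1' := 8 * q; pose p2 := q * ln n%:R.
have p1'0 : 0 < p1' by rewrite mulr_gt0.
have p1'1 : p1' < 1 by rewrite /p1'; lra.
have p21 : p2 < 1 by rewrite /p2; lra.
have hmu : spread_weight q H (2 ^ (i0 + r)) mu.
  split=> // S /muM /and3P[SH tS /eqP cS]; rewrite SH /= (leq_trans _ nr) //.
  have := card_cover_uniform Hk SH tS; rewrite cS cardsT card_ord => nE.
  by rewrite [leqRHS]nE leq_pmull.
have := fail_rounds p1'0 p1'1 qln p21 (ltW q0) (lexx _) qle hmu.
rewrite mu1 subrr add0r; set p3 := 1 - _ * _ => hfail.
have xr0 : 0 <= (1 - p1') ^+ r by rewrite exprn_ge0 // subr_ge0 ltW.
have xr1 : (1 - p1') ^+ r <= 1 by rewrite exprn_ile1 //; lra.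
have bern : 1 - r%:R * p1' <= (1 - p1') ^+ r.
  elim: (r) => [|j IHj]; first by rewrite mul0r subr0.
  rewrite exprS; have y0 : 0 <= 1 - p1' by lra.
  apply: le_trans (ler_wpM2l y0 IHj).
  have -> : (1 - p1') * (1 - j%:R * p1')
    = 1 - j.+1%:R * p1' + j%:R * (p1' * p1').
    by rewrite -natr1; ring.
  by rewrite lerDl !mulr_ge0 // ltW.
have hp3 : 0 <= p3 /\ p3 <= p.
  have p20 : 0 <= p2 := ltW qln.
  have : (1 - p1') ^+ r * (1 - p2) <= 1 by rewrite mulr_ile1 //; lra.
  have : (1 - r%:R * p1') - p2 <= (1 - p1') ^+ r * (1 - p2).
    have : (1 - p1') ^+ r * p2 <= p2 by rewrite ler_piMl.
    by rewrite mulrBr mulr1; lra.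
  have : r%:R * p1' <= 24 * p2.
    by rewrite /p1' /p2; have := ler_wpM2r (ltW q0) rln; lra.
  by rewrite /p3 pE -/p2; lra.
case: hp3 => p30 p3p.
have hp3 : 0 <= p3 <= 1 by rewrite p30 (le_trans p3p) // ltW.
apply: le_trans (random_sub_prob_le H p30 p3p p1 _); last first.
  move=> W W' WW' /existsP[M /and3P[MW tM cM]]; apply/existsP; exists M.
  by rewrite /perfect_matching (fintype.subset_trans MW WW') tM cM.
apply: (@le_trans _ _ (random_sub_prob p3 H (covers mu))); last first.
  apply: random_sub_prob_sub => // W /existsP[S /andP[/muM/and3P[_ tS cS] SW]].
  by apply/existsP; exists S; apply/and3P; split.
rewrite random_sub_probC lerD2l lerN2; apply: le_trans hfail _.
have h1 : 2 * 2^-1 ^+ i0 <= eta / 2.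
  have : 4 / eta <= 2 ^+ i0.
    by apply: le_trans (Hi0 (2 ^ i0)%N _) _; rewrite ?natrX // ltnW // ltn_expl.
  rewrite ler_pdivrMr // exprVn => h; rewrite ler_pdivrMr ?exprn_gt0 //; lra.
have h2 : B * (q / p2) <= eta / 2.
  have -> : q / p2 = (ln n%:R)^-1.
    by rewrite /p2 invfM mulrA divff ?mul1r // gt_eqF.
  rewrite ler_pdivrMr; last by lra.
  by rewrite ler_pdivrMr // in ln1; lra.
have := sum_halves R i0 r; rewrite -/B -/p2; lra.
Qed.

Local Open Scope classical_set_scope.
Local Open Scope ring_scope.

Theorem theorem1p5 (R : realType) (eps : R) (k l : nat)
    (eps_gt0 : 0 < eps) (l_ge1 : (1 <= l)%N) (l_le_k : (l <= k)%N) :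
  exists2 C : R, 0 < C &
    forall eta : R, 0 < eta ->
    \forall n \near \oo, (k %| n)%N ->
    forall H : {set {set 'I_n}}, uniform k H ->
      (dirac_threshold R l k + eps) * 'C(n, k - l)%:R <= (min_degree l H)%:R ->
      1 - eta <= random_sub_prob (Num.min 1 (C * ln n%:R / n%:R ^+ (k - 1))) H
                   (@has_perfect_matching _).
Proof.
have [C C0 [n0 Hn0]] := dirac_spread l_ge1 eps_gt0 l_le_k.
exists (25 * C) => [|eta eta0]; first by rewrite mulr_gt0.
have [n1 Hn1] := spread_matchings_prob (leq_trans l_ge1 l_le_k) C0 eta0.
exists (maxn n0 n1) => // n /=; rewrite geq_max => /andP[nn0 nn1] kn H Hk minH.
by apply: Hn1 => //; apply: Hn0.
Qed.
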